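(* Let $\Omega\subseteq\mathbb{R}^m$ be a smoothly bounded domain, and let $\{Y_\tau\}_{\tau\in\partial\Omega}$ be a family of random vectors in $\mathbb{R}^n$ parametrized by the boundary of $\Omega$, each $Y_\tau$ having finite expectation, with laws $\nu_{Y_\tau}$. For $x\in\Omega$ let $Y_x$ be a random vector with law $$\nu_{Y_x}:=\int_{\partial\Omega}\nu_{Y_\tau}\,d\mu_x(\tau),$$ where $\mu_x$ is the harmonic measure on $\partial\Omega$ with respect to $x$. Then the map $x\mapsto\left(E|\det M_{Y_x}|\right)^{1/n}$ is superharmonic in $x$.
   Context: A smoothly bounded domain is a bounded, connected open set with smooth boundary. For a random vector $Y$ in $\mathbb{R}^n$, its law $\nu_Y$ is the corresponding Borel probability measure on $\mathbb{R}^n$; finite expectation means $E\|Y\|<\infty$. $M_Y$ denotes the random $n\times n$ matrix whose columns are independent identically distributed copies of $Y$, and $E|\det M_Y|$ is the expected absolute value of its determinant. The harmonic measure $\mu_x$ ($x\in\Omega$) is the Borel probability measure on $\partial\Omega$ such that for every continuous $f:\partial\Omega\to\mathbb{R}$ the function $x\mapsto\int_{\partial\Omega}f\,d\mu_x$ is the harmonic function on $\Omega$ with boundary values $f$. The law $\nu_{Y_x}$ is the mixture $\nu_{Y_x}(S)=\int_{\partial\Omega}\nu_{Y_\tau}(S)\,d\mu_x(\tau)$ for Borel $S\subseteq\mathbb{R}^n$ (these integrals being understood to be defined). *)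

(* Defs.v *)
(* R^m, containing the domain, is 'rV[R]_m; the random vectors are columns, in 'cV[R]_n. *)
From mathcomp Require Import all_boot all_order all_algebra.
From mathcomp Require Import all_classical all_reals all_analysis.
From mathcomp Require Import measurable_realfun.

Set Implicit Arguments.
Unset Strict Implicit.
Unset Printing Implicit Defensive.
Import Order.TTheory GRing.Theory Num.Theory numFieldNormedType.Exports.

Local Open Scope classical_set_scope.
Local Open Scope ring_scope.

Definition boundary (T : topologicalType) (A : set T) : set T :=
  closure A `\` interior A.

(* T with its Borel sigma-algebra; this type is convertible to T. *)
Notation borel T := (g_sigma_algebraType (@open T)).

(* The Euclidean norm. The norm `|v| of the library is the sup norm: it gives
   the same topology and the same bounded sets, but other balls. *)
Definition enorm (R : realType) (p q : nat) (v : 'M[R]_(p, q)) : R :=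
  Num.sqrt (\sum_i \sum_j v i j ^+ 2).

Section Domains.
Variables (R : realType) (m : nat).
Implicit Types (U : set 'rV[R]_m) (f : 'rV[R]_m -> R).

Definition basis_vec (i : 'I_m) : 'rV[R]_m := delta_mx 0 i.

Definition partial (i : 'I_m) f : 'rV[R]_m -> R := fun x => 'D_(basis_vec i) f x.

(* f is of class C^k on the open set U. *)
Fixpoint is_Ck (k : nat) U f : Prop :=
  match k with
  | 0 => forall x, U x -> {for x, continuous f}
  | k'.+1 => (forall x, U x -> differentiable f x) /\
             (forall i, is_Ck k' U (partial i f))
  end.

Definition is_smooth U f := forall k, is_Ck k U f.

Definition laplacian f (x : 'rV[R]_m) : R := \sum_i partial i (partial i f) x.

Definition harmonic_on U f :=
  is_Ck 2 U f /\ forall x, U x -> laplacian f x = 0.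

(* Near each of its boundary points p, Omega is the sublevel set of a smooth
   function whose gradient at p is nonzero. *)
Definition smooth_boundary (Omega : set 'rV[R]_m) :=
  forall p, boundary Omega p ->
    exists (U : set 'rV[R]_m) (rho : 'rV[R]_m -> R),
      [/\ open U, U p, is_smooth U rho,
          (exists i, partial i rho p != 0)
        & Omega `&` U = [set x | rho x < 0] `&` U].

Definition smoothly_bounded_domain (Omega : set 'rV[R]_m) :=
  [/\ open Omega, connected Omega, bounded_set Omega & smooth_boundary Omega].

(* mu x is the harmonic measure of Omega at x, for x in Omega: a Borel
   probability measure carried by the boundary such that integration against it
   solves the Dirichlet problem. The values of mu outside Omega and those of f
   outside the boundary play no role. *)
Definition is_harmonic_measure (Omega : set 'rV[R]_m)
    (mu : 'rV[R]_m -> probability (borel 'rV[R]_m) R) :=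
  (forall x, Omega x -> mu x (boundary Omega) = 1%E) /\
  forall f : 'rV[R]_m -> R, {within boundary Omega, continuous f} ->
    let h x := \int[mu x]_(t in boundary Omega) f t in
    harmonic_on Omega h /\
    forall p, boundary Omega p -> h x @[x --> within Omega (nbhs p)] --> f p.

Definition eball (c : 'rV[R]_m) (r : R) := [set x | enorm (x - c) < r].
Definition closed_eball (c : 'rV[R]_m) (r : R) := [set x | enorm (x - c) <= r].
Definition esphere (c : 'rV[R]_m) (r : R) := [set x | enorm (x - c) = r].

(* Superharmonicity on the open set U of an extended-real-valued function, by
   comparison with harmonic functions on balls. As is common, the function
   identically +oo is allowed. *)
Definition superharmonic_on U (F : 'rV[R]_m -> \bar R) :=
  [/\ forall x, U x -> (-oo < F x)%E,
      forall x (a : R), U x -> (a%:E < F x)%E ->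
        \forall y \near within U (nbhs x), (a%:E < F y)%E
    & forall (c : 'rV[R]_m) (r : R) (h : 'rV[R]_m -> R),
        0 < r -> closed_eball c r `<=` U ->
        {within closed_eball c r, continuous h} ->
        harmonic_on (eball c r) h ->
        (forall y, esphere c r y -> ((h y)%:E <= F y)%E) ->
        forall y, eball c r y -> ((h y)%:E <= F y)%E].

End Domains.

Section RandomMatrices.
Variables (R : realType) (n : nat).

Definition finite_expectation d (S : measurableType d) (Q : probability S R)
    (Y : {RV Q >-> borel 'cV[R]_n}) :=
  ('E_Q[fun w => enorm (Y w : 'cV[R]_n)] < +oo)%E.

(* Mutual independence of a finite family; the product rule for subfamilies is
   the case where the other sets are the whole space. *)
Definition mutually_independent d d' (T : measurableType d)
    (T' : measurableType d') (P : probability T R) (k : nat)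
    (X : 'I_k -> T -> T') :=
  forall A : 'I_k -> set T', (forall i, measurable (A i)) ->
    P [set w | forall i, A i (X i w)] = (\prod_(i < k) P (X i @^-1` A i))%E.

(* M is the random matrix M_Y: its columns are independent copies of Y. *)
Definition iid_columns d d' (T : measurableType d) (S : measurableType d')
    (P : probability T R) (Q : probability S R)
    (M : T -> 'M[R]_n) (Y : {RV Q >-> borel 'cV[R]_n}) :=
  let X (j : 'I_n) : T -> borel 'cV[R]_n := fun w => col j (M w) in
  [/\ forall j, measurable_fun setT (X j),
      forall j (A : set (borel 'cV[R]_n)), measurable A ->
        P (X j @^-1` A) = distribution Q Y A
    & mutually_independent P X].

Definition expected_abs_det d (T : measurableType d) (P : probability T R)
    (M : T -> 'M[R]_n) : \bar R := 'E_P[fun w => `|\det (M w)|].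

End RandomMatrices.

(* Main.v *)
Require Import Defs.
From mathcomp Require Import all_boot all_order all_algebra.
From mathcomp Require Import all_classical all_reals all_analysis.
From mathcomp Require Import measurable_realfun.
From mathcomp Require Import perm ring lra.
From mathcomp Require finmap.

(* By the formula of Vitale, E|det M_Y| is n! times the volume of the zonoid of
   Y, and the zonoid of Y_x is the average of the zonoids of the Y_t against
   the harmonic measure; the statement is the Brunn-Minkowski inequality for
   such averages. Volumes are avoided: for a finitely supported law with weights
   w_b at the points v_b, E|det M| is the polynomial
   p(w) = sum_a prod_i w_(a i) |det (v_(a 1), ..., v_(a n))|, the volume
   polynomial of a zonotope. Its polarization satisfies the Alexandrov-Fenchel
   inequality, proved by induction on the number of arguments that are not point
   masses: the base case is the planar one, where the kernel |s - t| is negative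
   on sequences of sum zero, and the induction step is the Bochner-type argument
   of Shenfeld and van Handel. Hence p^(1/n) is concave and homogeneous, so at
   each point y of Omega it lies below a linear form in w with equality at y.
   As w_b(x) is the average of a function on the boundary against mu_x, the
   function p(w(x))^(1/n) lies below such averages with equality at y, so it
   inherits from them the comparison with harmonic functions on balls.
   For averages of continuous functions this comparison is the maximum
   principle; it extends to bounded Borel functions by approximation in L^1,
   since averages of functions with values in [0, 1] are equicontinuous (a
   gradient estimate that follows from the maximum principle with a quadratic
   barrier). General laws are reduced to finitely supported ones by discretizing
   (a uniform limit) and truncating (an increasing limit). *)

Set Implicit Arguments.
Unset Strict Implicit.
Unset Printing Implicit Defensive.
Import Order.TTheory GRing.Theory Num.Theory numFieldNormedType.Exports.

Local Open Scope classical_set_scope.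
Local Open Scope ring_scope.

(** * Lorentzian forms and mixed volumes of zonotopes *)

Section LorentzianForms.
Variables (R : realFieldType) (N : nat).
Implicit Types (K : 'I_N -> 'I_N -> R) (x y : 'I_N -> R).

Definition bil K x y : R := \sum_a \sum_b x a * y b * K a b.

(** The reversed Cauchy-Schwarz inequality. For a symmetric kernel it says that the form has at most
    one positive square in its signature. *)
Definition lorentzian K : Prop :=
  forall x y, 0 < bil K y y -> bil K x x * bil K y y <= bil K x y ^+ 2.

Lemma bilC K x y : (forall a b, K a b = K b a) -> bil K x y = bil K y x.
Proof.
move=> symK; rewrite /bil exchange_big; apply: eq_bigr => a _.
by apply: eq_bigr => b _; rewrite symK (mulrC (x _)).
Qed.

Lemma bilDl K x x' y s : bil K (fun a => x a + s * x' a) y = bil K x y + s * bil K x' y.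
Proof.
rewrite /bil mulr_sumr -big_split; apply: eq_bigr => a _ /=.
by rewrite mulr_sumr -big_split; apply: eq_bigr => b _ /=; ring.
Qed.

Lemma bilDr K x y y' s : bil K x (fun a => y a + s * y' a) = bil K x y + s * bil K x y'.
Proof.
rewrite /bil mulr_sumr -big_split; apply: eq_bigr => a _ /=.
by rewrite mulr_sumr -big_split; apply: eq_bigr => b _ /=; ring.
Qed.

Lemma bil_lin K x y s : (forall a b, K a b = K b a) ->
  bil K (fun a => x a + s * y a) (fun a => x a + s * y a) =
  bil K x x + 2 * s * bil K x y + s ^+ 2 * bil K y y.
Proof.
by move=> symK; rewrite bilDl !bilDr (bilC y x symK); ring.
Qed.

(** If the form is positive at [y], then [y] is off the hyperplane, so [x] can be moved into it
    along [y]. The quadratic polynomial in [s] given by the form at [x + s y] has positive leading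
    coefficient and takes a nonpositive value; hence its discriminant is nonnegative. *)
Lemma nonpos_on_hyperplane_lorentzian K (c : 'I_N -> R) :
    (forall a b, K a b = K b a) ->
    (forall x, \sum_a c a * x a = 0 -> bil K x x <= 0) ->
  lorentzian K.
Proof.
move=> symK negK x y qy.
have [cy0|cy0] := eqVneq (\sum_a c a * y a) 0; first by have := negK _ cy0; rewrite leNgt qy.
pose s := - (\sum_a c a * x a) / (\sum_a c a * y a).
have := negK (fun a => x a + s * y a).
rewrite bil_lin //.
have -> : \sum_a c a * (x a + s * y a) = 0.
  under eq_bigr do rewrite mulrDr mulrCA.
  by rewrite big_split /= -mulr_sumr /s mulrVK ?subrr ?unitfE.
move=> /(_ erefl) H.
set u := bil K x x in H *; set v := bil K x y in H *; set w := bil K y y in H qy *.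
have := sqr_ge0 (v + s * w); nra.
Qed.

Lemma absdiff_cons (p : R * R) (l : seq (R * R)) :
  \sum_(a <- p :: l) \sum_(b <- p :: l) a.2 * b.2 * `|a.1 - b.1| =
  \sum_(a <- l) \sum_(b <- l) a.2 * b.2 * `|a.1 - b.1| +
  2 * p.2 * \sum_(b <- l) b.2 * `|p.1 - b.1|.
Proof.
rewrite !big_cons subrr normr0 mulr0 add0r.
under [X in _ + X]eq_bigr do rewrite big_cons.
rewrite big_split /= addrA [LHS]addrC; congr (_ + _).
rewrite mulr_sumr -big_split /=; apply: eq_bigr => b _.
by rewrite (distrC b.1); ring.
Qed.

(** Induction on the number of points: moving the weight of the first point [p] onto its neighbour
    [q] raises the double sum by [2 * p.2 ^+ 2 * (p.1 - q.1)], because the weights other than [p.2]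
    sum to [- p.2]. *)
Lemma sorted_absdiff_le0 (l : seq (R * R)) :
    sorted (fun p q => q.1 <= p.1) l -> \sum_(p <- l) p.2 = 0 ->
  \sum_(p <- l) \sum_(q <- l) p.2 * q.2 * `|p.1 - q.1| <= 0.
Proof.
have [k] := ubnP (size l); elim: k l => // k IHk [|p [|q r]] /=.
- by rewrite !big_nil.
- by rewrite !big_seq1 subrr normr0 mulr0.
move=> szk /andP[qp srt] sum0.
have trans : transitive (fun p q : R * R => q.1 <= p.1).
  by move=> a b c /= ab ca; apply: le_trans ca ab.
have /allP rq := order_path_min trans srt.
pose q' := (q.1, p.2 + q.2).
have IH : \sum_(a <- q' :: r) \sum_(b <- q' :: r) a.2 * b.2 * `|a.1 - b.1| <= 0.
  apply: IHk => //=.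
    by case: (r) srt => //=.
  by rewrite big_cons /= -addrA; rewrite !big_cons in sum0.
apply: le_trans IH.
rewrite !absdiff_cons /= big_cons.
have -> : \sum_(b <- r) b.2 * `|p.1 - b.1| =
    (p.1 - q.1) * \sum_(b <- r) b.2 + \sum_(b <- r) b.2 * `|q.1 - b.1|.
  rewrite mulr_sumr -big_split; apply: eq_big_seq => b /rq /= bq.
  rewrite !ger0_norm ?subr_ge0 //; first by ring.
  exact: le_trans bq qp.
rewrite !big_cons in sum0.
have -> : \sum_(b <- r) b.2 = - p.2 - q.2 by lra.
rewrite ger0_norm ?subr_ge0 //.
set S1 := \sum_(a <- r) _; set S2 := \sum_(b <- r) _.
have := mulr_ge0 (sqr_ge0 p.2) (etrans (subr_ge0 _ _) qp).
lra.
Qed.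

Lemma absdiff_le0 (s c : 'I_N -> R) : \sum_a c a = 0 ->
  \sum_a \sum_b c a * c b * `|s a - s b| <= 0.
Proof.
move=> sum0; pose r := fun p q : R * R => q.1 <= p.1.
pose l := [seq (s a, c a) | a <- enum 'I_N].
have tot : total r by move=> p q; rewrite /r orbC; exact: le_total.
have E F : \sum_(p <- sort r l) F p = \sum_a F (s a, c a) :> R.
  rewrite (perm_big l) ?perm_sort //= big_map.
  by rewrite big_enum.
have := @sorted_absdiff_le0 (sort r l) (sort_sorted tot l).
rewrite !E => /(_ sum0); congr (_ <= 0); apply: eq_bigr => a _; exact: E.
Qed.

(** The relations make [w a b] a planar determinant of the vectors [(al a, be a)], up to the factor
    [k]. After rescaling, its absolute value is the distance of the slopes [s a] and [s b], and the
    form is nonpositive on the hyperplane where the rescaled weights [c] sum to zero. *)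
Lemma plucker_lorentzian (w : 'I_N -> 'I_N -> R) :
    (forall a b, w a b = - w b a) ->
    (forall a b c d, w a b * w c d = w a c * w b d - w a d * w b c) ->
  lorentzian (fun a b => `|w a b|).
Proof.
move=> altw gp.
have [/existsP[a0 /existsP[d0 nz]]|] := boolP [exists a, exists b, w a b != 0]; last first.
  move=> /existsPn nw x y.
  rewrite {1}/bil big1 ?ltxx // => a _; rewrite big1 // => b _.
  have /existsPn /(_ b) := nw a.
  by rewrite negbK => /eqP ->; rewrite normr0 mulr0.
pose al a := w a0 a; pose be a := w a d0; pose k := w a0 d0.
have k0 : `|k| != 0 by rewrite normr_eq0.
apply: (nonpos_on_hyperplane_lorentzian (c := fun a => `|al a|)).
  by move=> a b; rewrite altw normrN.
move=> x lx0.
pose s a := be a / al a; pose c a := x a * `|al a|.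
pose z a := (al a == 0)%:R * `|be a| * x a.
(* The vectors with [al a = 0] have infinite slope. They enter through [z], whose terms always carry
   a factor [c], so these cancel on the hyperplane. *)
have E a b : x a * x b * `|w a b| =
    `|k|^-1 * (c a * c b * `|s a - s b|) + `|k|^-1 * (z a * c b + c a * z b).
  have -> : w a b = (be a * al b - al a * be b) / k.
    apply: (mulIf nz); rewrite mulfVK //.
    by rewrite gp /al /be (altw a a0) (altw b a0) /k; ring.
  rewrite normrM normfV /c /z /s.
  have [-> /=|a_n0] := eqVneq (al a) 0; have [-> /=|b_n0] := eqVneq (al b) 0.
  - by rewrite !mulr0 mul0r subrr !normr0; ring.
  - by rewrite mul0r subr0 normr0 normrM; ring.
  - by rewrite mulr0 sub0r normrN normr0 normrM; ring.
  - have -> : be a * al b - al a * be b = (be a / al a - be b / al b) * al a * al b by field; apply/andP.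
    by rewrite !normrM /=; ring.
have -> : bil (fun a b => `|w a b|) x x = `|k|^-1 * (\sum_a \sum_b c a * c b * `|s a - s b|)
   + `|k|^-1 * ((\sum_a z a) * (\sum_b c b) + (\sum_a c a) * (\sum_b z b)).
  rewrite /bil !mulr_suml -big_split !mulr_sumr -big_split /=; apply: eq_bigr => a _.
  rewrite !mulr_sumr -big_split !mulr_sumr -big_split /=; apply: eq_bigr => b _.
  exact: E.
have c0 : \sum_a c a = 0 by rewrite -[RHS]lx0; apply: eq_bigr => a _; rewrite /c mulrC.
rewrite c0 mulr0 mul0r addr0 mulr0 addr0.
by rewrite pmulr_rle0 ?invr_gt0 ?lt_def ?k0 /= ?normr_ge0 // absdiff_le0.
Qed.
End LorentzianForms.

(** * The induction step: contraction of a tensor with Lorentzian slices *)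

Section TensorStep.
Variables (R : realType) (N : nat).
Implicit Types (K : 'I_N -> 'I_N -> R) (x y c D : 'I_N -> R).

(** The form attains its maximum on the compact set of vectors of the hyperplane with [D]-norm 1;
    the vector [x] shows that this maximum is positive. *)
Lemma rayleigh_maximizer K c D x :
    (forall a, 0 < D a) -> \sum_a c a * x a = 0 -> 0 < bil K x x ->
  exists (f : 'I_N -> R) (lam : R), [/\ 0 < lam, \sum_a c a * f a = 0,
    \sum_a D a * f a ^+ 2 = 1, bil K f f = lam
    & forall g, \sum_a c a * g a = 0 -> bil K g g <= lam * \sum_a D a * g a ^+ 2].
Proof.
move=> D0 cx qx.
pose nrm (g : 'I_N -> R) := \sum_a D a * g a ^+ 2.
have nrm_ge0 g : 0 <= nrm g.
  by apply: sumr_ge0 => a _; rewrite mulr_ge0 ?sqr_ge0 ?ltW.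
have bilZ s g : bil K (fun a => s * g a) (fun a => s * g a) = s ^+ 2 * bil K g g.
  rewrite /bil mulr_sumr; apply: eq_bigr => a _.
  by rewrite mulr_sumr; apply: eq_bigr => b _; ring.
have nrmZ s g : nrm (fun a => s * g a) = s ^+ 2 * nrm g.
  by rewrite /nrm mulr_sumr; apply: eq_bigr => a _; ring.
have cZ s g : \sum_a c a * (s * g a) = s * \sum_a c a * g a.
  by rewrite mulr_sumr; apply: eq_bigr => a _; ring.
have nrm0 g : nrm g = 0 -> bil K g g = 0.
  move=> /eqP; rewrite psumr_eq0; last first.
    by move=> a _; rewrite mulr_ge0 ?sqr_ge0 ?ltW.
  move=> /allP g0; rewrite /bil big1 // => a _; rewrite big1 // => b _.
  have := g0 a; rewrite mem_index_enum /= => /(_ isT).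
  by rewrite mulf_eq0 gt_eqF //= expf_eq0 /= => /eqP ->; rewrite !mul0r.
have normalize g : 0 < nrm g -> exists2 s, 0 < s & s ^+ 2 * nrm g = 1.
  move=> g0; exists (Num.sqrt (nrm g))^-1; first by rewrite invr_gt0 sqrtr_gt0.
  by rewrite exprVn sqr_sqrtr ?nrm_ge0 // mulVf // gt_eqF.
have cts_coord (a : 'I_N) : continuous (fun v : 'rV[R]_N => v ord0 a).
  exact: coord_continuous.
pose A := [set v : 'rV[R]_N | \sum_a c a * v ord0 a = 0 /\ nrm (v ord0) = 1].
have cts_c : continuous (fun v : 'rV[R]_N => \sum_a c a * v ord0 a).
  apply: (continuous_big (@add_continuous _)) => a _ v.
  exact: (cvgM (cvg_cst (c a)) (cts_coord a v)).
have cts_nrm : continuous (fun v : 'rV[R]_N => nrm (v ord0)).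
  apply: (continuous_big (@add_continuous _)) => a _ v.
  exact: (cvgM (cvg_cst (D a)) (cvgM (cts_coord a v) (cts_coord a v))).
have cts_bil : continuous (fun v : 'rV[R]_N => bil K (v ord0) (v ord0)).
  apply: (continuous_big (@add_continuous _)) => a _.
  apply: (continuous_big (@add_continuous _)) => b _ v.
  exact: (cvgM (cvgM (cts_coord a v) (cts_coord b v)) (cvg_cst (K a b))).
have cptA : compact A.
  (* The bound [1 + (D a)^-1] is at least the square root of [(D a)^-1]. *)
  pose box := [set v : 'rV[R]_N | forall a, `[- (1 + (D a)^-1), 1 + (D a)^-1]%classic (v ord0 a)].
  apply: (@subclosed_compact _ A box).
  - rewrite (_ : A = (fun v : 'rV[R]_N => \sum_a c a * v ord0 a) @^-1` [set x | x = 0]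
        `&` (fun v : 'rV[R]_N => nrm (v ord0)) @^-1` [set x | x = 1]); last by [].
    apply: closedI; apply: preimage_closed; try exact: closed_eq.
      by move=> v _; exact: cts_c.
    by move=> v _; exact: cts_nrm.
  - apply: (@rV_compact _ _ (fun a => `[- (1 + (D a)^-1), 1 + (D a)^-1]%classic)) => a.
    exact: segment_compact.
  - move=> v [_ nv] a; rewrite /= in_itv /= -ler_norml.
    have Dv : D a * v ord0 a ^+ 2 <= 1.
      rewrite -nv /nrm (bigD1 a) //= lerDl sumr_ge0 // => b _.
      by rewrite mulr_ge0 ?sqr_ge0 ?ltW.
    have {}Dv : `|v ord0 a| ^+ 2 <= (D a)^-1.
      by rewrite real_normK ?num_real // -[leRHS]mulr1 ler_pdivlMl.
    have := normr_ge0 (v ord0 a); have : 0 < (D a)^-1 by rewrite invr_gt0.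
    nra.
have nx : 0 < nrm x.
  rewrite lt_def nrm_ge0 andbT; apply/eqP => /nrm0 qx0.
  by rewrite qx0 ltxx in qx.
have [s s0 nsx] := normalize x nx.
pose v0 : 'rV[R]_N := \row_a (s * x a).
have v0E : v0 ord0 = (fun a => s * x a) by apply/funext => a; rewrite mxE.
have Av0 : A v0 by split; rewrite v0E ?cZ ?cx ?mulr0 // nrmZ.
have [] := compact_EVT_max (ex_intro _ _ Av0) cptA (continuous_subspaceT cts_bil).
move=> f /set_mem[cf nf] fmax.
have fpos : 0 < bil K (f ord0) (f ord0).
  have := fmax _ (mem_set Av0); apply: lt_le_trans.
  by rewrite v0E bilZ mulr_gt0 // exprn_gt0.
exists (f ord0), (bil K (f ord0) (f ord0)); split=> // g cg.
have [ng0|ng0] := eqVneq (nrm g) 0; first by rewrite nrm0 //; apply: mulr_ge0 (ltW fpos) (nrm_ge0 g).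
have {ng0}ng : 0 < nrm g by rewrite lt_def ng0 nrm_ge0.
have [t t0 ntg] := normalize g ng.
pose v1 : 'rV[R]_N := \row_a (t * g a).
have v1E : v1 ord0 = (fun a => t * g a) by apply/funext => a; rewrite mxE.
have Av1 : A v1 by split; rewrite v1E ?cZ ?cg ?mulr0 // nrmZ.
have := fmax _ (mem_set Av1); rewrite v1E bilZ => tg.
rewrite -(ler_pM2l (exprn_gt0 2 t0)) mulrCA ntg mulr1.
exact: tg.
Qed.

(** First variation: along [f + s g] the excess of the form over [lam] times the norm is
    [2 s p + s ^+ 2 r], which cannot be nonpositive for all [s] unless [p = 0]. *)
Lemma rayleigh_stationary K c D f lam g :
    (forall a b, K a b = K b a) -> \sum_a c a * f a = 0 ->
    bil K f f = lam * \sum_a D a * f a ^+ 2 ->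
    (forall g, \sum_a c a * g a = 0 -> bil K g g <= lam * \sum_a D a * g a ^+ 2) ->
    \sum_a c a * g a = 0 ->
  bil K f g = lam * \sum_a D a * f a * g a.
Proof.
move=> symK cf qf maxf cg.
pose p := bil K f g - lam * \sum_a D a * f a * g a.
pose r := bil K g g - lam * \sum_a D a * g a ^+ 2.
have r0 : r <= 0 by rewrite subr_le0 maxf.
have H s : 2 * s * p + s ^+ 2 * r <= 0.
  have := maxf (fun a => f a + s * g a); rewrite bil_lin // qf.
  have -> : \sum_a D a * (f a + s * g a) ^+ 2 = \sum_a D a * f a ^+ 2 +
      2 * s * (\sum_a D a * f a * g a) + s ^+ 2 * \sum_a D a * g a ^+ 2.
    rewrite !mulr_sumr -!big_split /=; apply: eq_bigr => a _; ring.
  have -> : \sum_a c a * (f a + s * g a) = 0.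
    under eq_bigr do rewrite mulrDr mulrCA.
    by rewrite big_split /= -mulr_sumr cf cg mulr0 addr0.
  by move=> /(_ erefl); rewrite /p /r; lra.
apply/eqP; rewrite -subr_eq0 -/p; apply/eqP.
have r1 : 0 < 1 - r by lra.
(* Since [r <= 0], this value of [s] is defined and turns the excess into [p ^+ 2] times a positive
   factor. *)
have := H (p / (1 - r)).
have -> : 2 * (p / (1 - r)) * p + (p / (1 - r)) ^+ 2 * r = p ^+ 2 * ((2 - r) / (1 - r) ^+ 2).
  by field; rewrite gt_eqF.
rewrite pmulr_lle0; last by rewrite divr_gt0 ?exprn_gt0 //; lra.
by move=> p2; apply/eqP; rewrite -sqrf_eq0 eq_le p2 sqr_ge0.
Qed.

(* The [a]-th entry of [A] applied to [x] is the value of the form [T _ _ a] at [x] and [y];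
   the Lorentzian property of these forms, summed with weights, bounds the form of [A] by the square of the operator [A]
   normalized so as to fix [y]. Its eigenvalues are thus at most 0 or at least 1, while by
   connectedness 1 is its largest eigenvalue, with [y] as only eigenvector. *)
Lemma lorentzian_tensor (T : 'I_N -> 'I_N -> 'I_N -> R) y :
    (forall a, 0 < y a) -> (forall a b d, 0 <= T a b d) ->
    (forall a b d, T a b d = T b a d) -> (forall a b d, T a b d = T a d b) ->
    (forall d, lorentzian (fun a b => T a b d)) ->
    let A a b := \sum_d y d * T a b d in
    (forall a b, (exists t, 0 < A a t) -> (exists t, 0 < A b t) ->
      0 < A a b \/ exists2 t, 0 < A a t & 0 < A b t) ->
  lorentzian A.
Proof.
move=> y0 T0 T12 T23 LT A conn.
have A0 a b : 0 <= A a b by apply: sumr_ge0 => c _; rewrite mulr_ge0 // ltW.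
have symA a b : A a b = A b a by apply: eq_bigr => c _; rewrite T12.
pose L x a := \sum_b A a b * x b.
have L0 a : 0 <= L y a by apply: sumr_ge0 => b _; rewrite mulr_ge0 // ltW.
have bilL x z : bil A x z = \sum_a x a * L z a.
  apply: eq_bigr => a _; rewrite mulr_sumr; apply: eq_bigr => b _; ring.
have Lbil x a : L x a = bil (fun a' b => T a' b a) x y.
  rewrite /L /bil; apply: eq_bigr => b _; rewrite /A mulr_suml; apply: eq_bigr => c _.
  rewrite T12 T23; ring.
have L_null a : L y a = 0 -> forall b, A a b = 0.
  move=> /eqP; rewrite psumr_eq0; last by move=> b _; rewrite mulr_ge0 // ltW.
  move=> /allP H b; have := H b; rewrite mem_index_enum => /(_ isT) /=.
  by rewrite mulf_eq0 (gt_eqF (y0 b)) orbF => /eqP.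
have L_null' a x : L y a = 0 -> L x a = 0.
  by move=> /L_null H; rewrite /L big1 // => b _; rewrite H mul0r.
(* This is the sum with weights [y a] of the Lorentzian inequalities of the slices, tested against
   [y]. If [L y a = 0], the slice vanishes and so does the quotient, by the convention on division
   by zero. *)
have key x : bil A x x <= \sum_a y a * (L x a ^+ 2 / L y a).
  have -> : bil A x x = \sum_a y a * bil (fun a' b => T a' b a) x x.
    rewrite /bil; under [RHS]eq_bigr do rewrite mulr_sumr.
    rewrite [RHS]exchange_big; apply: eq_bigr => a _.
    under [RHS]eq_bigr do rewrite mulr_sumr.
    rewrite [RHS]exchange_big; apply: eq_bigr => b _.
    by rewrite mulr_sumr; apply: eq_bigr => c _ /=; ring.
  apply: ler_sum => a _; rewrite ler_pM2l //.
  have [Ly0|Ly0] := eqVneq (L y a) 0.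
    rewrite Ly0 invr0 mulr0 {1}/bil big1 // => b _; rewrite big1 // => b' _.
    have /eqP := L_null _ Ly0 b; rewrite psumr_eq0; last first.
      by move=> c _; rewrite mulr_ge0 // ltW.
    move=> /allP /(_ b'); rewrite mem_index_enum => /(_ isT) /=.
    by rewrite mulf_eq0 (gt_eqF (y0 b')) /= T12 T23 => /eqP ->; rewrite mulr0.
  have {Ly0}Ly : 0 < L y a by rewrite lt_def Ly0 L0.
  rewrite ler_pdivlMr // !Lbil.
  by apply: LT; rewrite -Lbil.
apply: (nonpos_on_hyperplane_lorentzian (c := L y)) => // x Lx0.
rewrite leNgt; apply/negP => qx.
(* With these weights [y] is fixed by [L] divided by [D]. The value 1 only keeps [D] positive where
   a row of [A] is zero. *)
pose D a := if L y a == 0 then 1 else L y a / y a.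
have D0 a : 0 < D a.
  rewrite /D; case: eqVneq => // Ly; rewrite divr_gt0 //.
  by rewrite lt_def Ly L0.
have [f [lam [lam0 cf nf qf maxf]]] := rayleigh_maximizer D0 Lx0 qx.
have qf' : bil A f f = lam * \sum_a D a * f a ^+ 2 by rewrite nf mulr1.
(* The residual of the eigenvalue equation. It lies in the hyperplane, as [A] is symmetric and [y]
   is an eigenvector, so stationarity may be tested against it and shows that its norm is zero. *)
pose g a := L f a / D a - lam * f a.
have cg : \sum_a L y a * g a = 0.
  have -> : \sum_a L y a * g a = \sum_a y a * L f a - lam * \sum_a L y a * f a.
    rewrite mulr_sumr -sumrB; apply: eq_bigr => a _.
    rewrite /g /D; case: eqVneq => Ly; first by rewrite Ly (L_null' _ f Ly); ring.
    by field; rewrite Ly gt_eqF.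
  rewrite cf mulr0 subr0 -bilL (bilC _ _ symA) bilL -[RHS]cf.
  by apply: eq_bigr => a _; rewrite mulrC.
have := rayleigh_stationary symA cf qf' maxf cg.
rewrite (bilC _ _ symA) bilL => /eqP; rewrite -subr_eq0 mulr_sumr -sumrB => /eqP Hg.
have {Hg}Lf a : L f a = lam * D a * f a.
  have : \sum_a D a * g a ^+ 2 = 0.
    rewrite -[RHS]Hg; apply: eq_bigr => b _.
    by rewrite /g; field; rewrite gt_eqF.
  move=> /eqP; rewrite psumr_eq0; last by move=> b _; rewrite mulr_ge0 ?sqr_ge0 // ltW.
  move=> /allP /(_ a); rewrite mem_index_enum => /(_ isT) /=.
  rewrite mulf_eq0 gt_eqF //= sqrf_eq0 subr_eq0 => /eqP H.
  by rewrite -[LHS](divfK (lt0r_neq0 (D0 a))) H; ring.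
have f_null a : L y a = 0 -> f a = 0.
  move=> Ly; have := Lf a; rewrite (L_null' _ _ Ly) => /esym/eqP.
  by rewrite !mulf_eq0 (gt_eqF lam0) (gt_eqF (D0 a)) => /eqP.
(* At the eigenvector [f] the inequality [key] reads [lam <= lam ^+ 2]. *)
have lam1 : 1 <= lam.
  have := key f; rewrite qf.
  have -> : \sum_a y a * (L f a ^+ 2 / L y a) = lam ^+ 2 * \sum_a D a * f a ^+ 2.
    rewrite mulr_sumr; apply: eq_bigr => a _; rewrite Lf /D.
    case: eqVneq => Ly; first by rewrite (f_null _ Ly) Ly invr0; ring.
    by field; rewrite Ly gt_eqF.
  by rewrite nf mulr1 expr2 -[leLHS]mulr1 ler_pM2l.
pose h a := f a / y a.
(* The Dirichlet form of [h = f / y]: a sum of nonnegative terms equal to [2 * (1 - lam) <= 0], so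
   [h] agrees at any two indices joined by a positive entry of [A]. *)
have dir : \sum_a \sum_b A a b * y a * y b * (h a - h b) ^+ 2 = 2 * (1 - lam).
  have -> : 2 * (1 - lam) = \sum_a D a * f a ^+ 2 + \sum_a D a * f a ^+ 2 - 2 * bil A f f.
    by rewrite nf qf; ring.
  have E1 : \sum_a D a * f a ^+ 2 = \sum_a \sum_b A a b * y b * (f a ^+ 2 / y a).
    apply: eq_bigr => a _; rewrite -mulr_suml -/(L y a) /D.
    by case: eqVneq => Ly; [rewrite (f_null _ Ly); ring | field; rewrite gt_eqF].
  have E2 : \sum_a D a * f a ^+ 2 = \sum_a \sum_b A a b * y a * (f b ^+ 2 / y b).
    rewrite E1 exchange_big; apply: eq_bigr => a _; apply: eq_bigr => b _.
    by rewrite symA.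
  rewrite {1}E1 E2 /bil mulr_sumr -!big_split -sumrB; apply: eq_bigr => a _.
  rewrite mulr_sumr -!big_split -sumrB; apply: eq_bigr => b _ /=.
  by rewrite /h; field; rewrite !gt_eqF.
have adj a b : 0 < A a b -> h a = h b.
  move=> Aab; apply/eqP; rewrite -subr_eq0 -sqrf_eq0 eq_le sqr_ge0 andbT.
  have c0 : 0 < A a b * y a * y b by rewrite !mulr_gt0.
  rewrite -(pmulr_rle0 _ c0); apply: le_trans (_ : 2 * (1 - lam) <= 0); last by lra.
  have t0 a' b' : 0 <= A a' b' * y a' * y b' * (h a' - h b') ^+ 2.
    by rewrite mulr_ge0 ?sqr_ge0 // !mulr_ge0 ?A0 // ltW.
  rewrite -dir (bigD1 a) //= (bigD1 b) //= -addrA lerDl addr_ge0 ?sumr_ge0 // => a' _.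
  by rewrite sumr_ge0.
have [a0 fa0] : exists a, f a != 0.
  apply/existsP; apply: contraPT nf => /existsPn f0.
  rewrite big1 => [|a _]; first by move/esym/eqP; rewrite oner_eq0.
  by have := f0 a; rewrite negbK => /eqP ->; rewrite expr0n mulr0.
have supp a : L y a != 0 -> exists t, 0 < A a t.
  move=> Ly; apply/existsP; apply: contraNT Ly => /existsPn H.
  apply/eqP; apply: big1 => b _; have := H b; rewrite -leNgt => Ab.
  have -> : A a b = 0 by apply/eqP; rewrite eq_le Ab A0.
  by rewrite mul0r.
have La0 : L y a0 != 0 by apply: contraNneq fa0 => /f_null ->.
(* By connectedness [f] is a nonzero multiple of [y] on the nonzero rows of [A], which contradicts
   its membership in the hyperplane. *)
have hc a : L y a != 0 -> h a = h a0.
  move=> La; case: (conn a a0 (supp _ La) (supp _ La0)); first exact: adj.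
  by move=> [t /adj -> /adj ->].
have : \sum_a L y a * f a = h a0 * \sum_a L y a * y a.
  rewrite mulr_sumr; apply: eq_bigr => a _.
  have [->|La] := eqVneq (L y a) 0; first by rewrite !mul0r mulr0.
  by rewrite -(hc _ La) /h; field; rewrite gt_eqF.
rewrite cf => /esym/eqP; rewrite mulf_eq0 => /orP[].
  by rewrite /h mulf_eq0 (negPf fa0) invr_eq0 gt_eqF.
rewrite psumr_eq0; last by move=> a _; rewrite mulr_ge0 // ltW.
move=> /allP /(_ a0); rewrite mem_index_enum => /(_ isT) /=.
by rewrite mulf_eq0 (negPf La0) gt_eqF.
Qed.
End TensorStep.

(** * Cramer's rule and the Plücker relation *)

Section RowReplacement.
Variables (R : fieldType) (n : nat).
Implicit Types (A : 'M[R]_n) (u : 'rV[R]_n).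

Definition set_row A i u : 'M[R]_n := \matrix_(k, l) (if k == i then u 0 l else A k l).

Lemma row_set_row A i u k : row k (set_row A i u) = if k == i then u else row k A.
Proof. by apply/rowP => l; rewrite !mxE; case: eqP => // _; rewrite mxE. Qed.

Lemma det_set_rowE A i u : \det (set_row A i u) = \sum_l u 0 l * cofactor A i l.
Proof.
rewrite (expand_det_row _ i); apply: eq_bigr => l _; rewrite mxE eqxx.
congr (_ * (_ * \det _)); apply/matrixP => p q; rewrite !mxE.
by rewrite eq_sym (negPf (neq_lift i p)).
Qed.

Lemma det_set_row_sum A i m (c : 'I_m -> R) (u : 'I_m -> 'rV[R]_n) :
  \det (set_row A i (\sum_k c k *: u k)) = \sum_k c k * \det (set_row A i (u k)).
Proof.
rewrite det_set_rowE; under eq_bigr do rewrite summxE mulr_suml.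
rewrite exchange_big; apply: eq_bigr => k _; rewrite det_set_rowE mulr_sumr.
by apply: eq_bigr => l _; rewrite mxE mulrA.
Qed.

Lemma det_set_row_row A i k : k != i -> \det (set_row A i (row k A)) = 0.
Proof.
move=> ki; apply: (determinant_alternate ki) => l.
by rewrite !mxE eqxx (negPf ki).
Qed.

Lemma set_row_id A i : set_row A i (row i A) = A.
Proof. by apply/matrixP => k l; rewrite !mxE; case: eqP => // ->. Qed.

Lemma cramer_row A u : \det A != 0 ->
  u = \sum_k (\det (set_row A k u) / \det A) *: row k A.
Proof.
move=> dA; have uA : A \in unitmx by rewrite unitmxE unitfE.
have E : u = \sum_k (u *m invmx A) 0 k *: row k A by rewrite -mulmx_sum_row mulmxKV.
rewrite {1}E; apply: eq_bigr => k _; congr (_ *: _).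
rewrite {2}E det_set_row_sum (bigD1 k) //= set_row_id big1 ?addr0 ?mulfK //.
by move=> l lk; rewrite det_set_row_row ?mulr0.
Qed.

Lemma det_row_swap A i j u w : i != j ->
  \det (set_row (set_row A i u) j w) = - \det (set_row (set_row A i w) j u).
Proof.
move=> ij.
have -> : set_row (set_row A i u) j w = row_perm (tperm i j) (set_row (set_row A i w) j u).
  apply/matrixP => k l; rewrite !mxE.
  case: tpermP => [->|->|/eqP/negPf ki /eqP/negPf kj].
  - by rewrite !eqxx (negPf ij).
  - by rewrite !eqxx (negPf ij).
  - by rewrite ki kj.
by rewrite row_permE det_mulmx det_perm odd_tperm ij expr1 mulN1r.
Qed.

(** If some [W e f] is nonzero, vectors are expanded in the rows of that matrix. Only the
    coordinates along [e] and [f] contribute, so [W x y] is a 2 by 2 minor of coordinates up to a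
    factor, and the relation becomes a polynomial identity. *)
Lemma plucker A i j (p q r s : 'rV[R]_n) : i != j ->
  let W x y := \det (set_row (set_row A i x) j y) in
  W p q * W r s = W p r * W q s - W p s * W q r.
Proof.
move=> ij W.
have altW x y : W x y = - W y x by exact: det_row_swap.
have [[e [f Wef]]|nW] := pselect (exists e f, W e f != 0); last first.
  have W0 x y : W x y = 0.
    by apply/eqP/negPn/negP => xy; apply: nW; exists x, y.
  by rewrite !W0 !mul0r subrr.
have setC x y : set_row (set_row A i x) j y = set_row (set_row A j y) i x.
  apply/matrixP => k l; rewrite !mxE; case: (eqVneq k j) => // ->.
  by rewrite eq_sym (negPf ij).
have setK x y z : set_row (set_row (set_row A i x) j y) i z = set_row (set_row A i z) j y.
  by apply/matrixP => k l; rewrite !mxE; case: (eqVneq k i) => // ->; rewrite (negPf ij).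
have setK' x y z : set_row (set_row (set_row A i x) j y) j z = set_row (set_row A i x) j z.
  by apply/matrixP => k l; rewrite !mxE; case: (eqVneq k j).
have dec x y : W x y = (W x f * W e y + W e x * W f y) / W e f.
  have := cramer_row x Wef; set B := set_row (set_row A i e) j f => xE.
  rewrite {1}xE /W setC det_set_row_sum.
  rewrite (bigD1 i) // (bigD1 j) ?(eq_sym j) //= big1 => [|k /andP[ki kj]].
    rewrite -!setC !row_set_row eqxx (negPf ij) eqxx.
    by rewrite /B setK setK' -/(W _ _) -/(W _ _) -/(W _ _) -/(W _ _); field.
  rewrite -setC row_set_row (negPf kj) row_set_row (negPf ki).
  have -> : \det (set_row (set_row A i (row k A)) j y) = 0; last by rewrite mulr0.
  apply: (determinant_alternate ki) => l.
  by rewrite !mxE (negPf ij) (negPf kj) (negPf ki) eqxx.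
have {}dec x y : W x y = (W x f * W e y - W e x * W y f) / W e f.
  by rewrite dec (altW f y) mulrN.
rewrite (dec p q) (dec r s) (dec p r) (dec q s) (dec p s) (dec q r).
by field.
Qed.
End RowReplacement.

(** * The Alexandrov-Fenchel inequality for zonotopes *)

Section MixedVolume.
Variables (R : realType) (n N : nat) (v : 'I_N -> 'rV[R]_n).
Implicit Types (X : 'I_n -> 'I_N -> R) (x y : 'I_N -> R).

Definition frame (a : 'I_n -> 'I_N) : 'M[R]_n := \matrix_i v (a i).

(* [n`!] times the mixed volume of the zonotopes [\sum_b X i b *: [0, v b]]. *)
Definition mixed X : R :=
  \sum_(a : {ffun 'I_n -> 'I_N}) (\prod_i X i (a i)) * `|\det (frame a)|.

Definition upd T (f : 'I_n -> T) i (z : T) : 'I_n -> T := fun k => if k == i then z else f k.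

(** As a weight vector this stands for the single segment [[0, v b]]. *)
Definition point_mass (b : 'I_N) : 'I_N -> R := fun c => (c == b)%:R.

Lemma frame_upd (a : 'I_n -> 'I_N) i b : frame (upd a i b) = set_row (frame a) i (v b).
Proof. by apply/matrixP => k l; rewrite !mxE /upd; case: eqP. Qed.

Lemma updC T (f : 'I_n -> T) i j z z' : i != j ->
  upd (upd f i z) j z' = upd (upd f j z') i z.
Proof.
move=> ij; apply/funext => k; rewrite /upd; case: (eqVneq k j) => // ->.
by rewrite eq_sym (negPf ij).
Qed.

Lemma upd_id T (f : 'I_n -> T) i : upd f i (f i) = f.
Proof. by apply/funext => k; rewrite /upd; case: eqP => // ->. Qed.

Lemma mixed_ge0 X : (forall i b, 0 <= X i b) -> 0 <= mixed X.
Proof.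
by move=> X0; apply: sumr_ge0 => a _; rewrite mulr_ge0 // prodr_ge0.
Qed.

Lemma mixed_gt0P X : (forall i b, 0 <= X i b) ->
  0 < mixed X <-> exists2 a : 'I_n -> 'I_N, (forall i, 0 < X i (a i)) & \det (frame a) != 0.
Proof.
move=> X0; have t0 (a : {ffun 'I_n -> 'I_N}) : 0 <= (\prod_i X i (a i)) * `|\det (frame a)|.
  by rewrite mulr_ge0 // prodr_ge0.
split=> [|[a Xa da]].
  rewrite lt_def mixed_ge0 // andbT psumr_eq0 //.
  case/allPn => a _; rewrite mulf_eq0 negb_or normr_eq0 => /andP[/prodf_neq0 Xa da].
  by exists a => // i; rewrite lt_def X0 Xa.
have fE : frame [ffun i => a i] = frame a by apply/matrixP => k l; rewrite !mxE ffunE.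
rewrite /mixed (bigD1 [ffun i => a i]) //= fE ltr_wpDr ?sumr_ge0 //.
by rewrite mulr_gt0 ?normr_gt0 // prodr_gt0 // => i _; rewrite ffunE.
Qed.

Lemma mixed_upd X i x : mixed (upd X i x) = \sum_b x b * mixed (upd X i (point_mass b)).
Proof.
pose r (a : 'I_n -> 'I_N) := (\prod_(k | k != i) X k (a k)) * `|\det (frame a)|.
have E z : mixed (upd X i z) = \sum_(a : {ffun 'I_n -> 'I_N}) z (a i) * r a.
  apply: eq_bigr => a _; rewrite (bigD1 i) //= {1}/upd eqxx -mulrA.
  congr (_ * (_ * _)); apply: eq_bigr => k /negPf ki.
  by rewrite /upd ki.
rewrite E; under [RHS]eq_bigr do rewrite E mulr_sumr.
rewrite exchange_big; apply: eq_bigr => a _ /=.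
rewrite (bigD1 (a i)) //= big1 => [|b /negPf bi].
  by rewrite /point_mass eqxx mul1r addr0.
by rewrite /point_mass eq_sym bi mul0r mulr0.
Qed.

Lemma mixed_perm X (s : {perm 'I_n}) : mixed (fun i => X (s i)) = mixed X.
Proof.
pose h (t : {perm 'I_n}) (a : {ffun 'I_n -> 'I_N}) : {ffun 'I_n -> 'I_N} := [ffun i => a (t i)].
have hK : cancel (h s) (h (s^-1)%g) by move=> a; apply/ffunP => i; rewrite !ffunE permKV.
have hK' : cancel (h (s^-1)%g) (h s) by move=> a; apply/ffunP => i; rewrite !ffunE permK.
rewrite /mixed (reindex (h s)); last by apply: onW_bij; exists (h (s^-1)%g).
apply: eq_bigr => a _; congr (_ * _).
  by rewrite [RHS](reindex_inj (@perm_inj _ s)); apply: eq_bigr => i _; rewrite ffunE.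
have -> : frame (h s a) = row_perm s (frame a).
  by apply/matrixP => k l; rewrite !mxE ffunE.
by rewrite row_permE det_mulmx det_perm normrM normrX normrN1 expr1n mul1r.
Qed.

Lemma mixed_swap X i j x y : i != j ->
  mixed (upd (upd X i x) j y) = mixed (upd (upd X i y) j x).
Proof.
move=> ij; rewrite -(mixed_perm _ (tperm i j)); congr mixed; apply/funext => k.
rewrite /upd; case: tpermP => [->|->|/eqP/negPf ki /eqP/negPf kj].
- by rewrite !eqxx (negPf ij).
- by rewrite !eqxx (negPf ij).
- by rewrite ki kj.
Qed.

(** By bilinearity, the Lorentzian property of the kernel on point masses becomes the
    Alexandrov-Fenchel inequality for arbitrary weights in the slots [i] and [j]. *)
Lemma bil_mixed X i j x y : i != j ->
  bil (fun a b => mixed (upd (upd X i (point_mass a)) j (point_mass b))) x y =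
  mixed (upd (upd X i x) j y).
Proof.
move=> ij; rewrite mixed_upd /bil exchange_big; apply: eq_bigr => b _ /=.
rewrite updC // mixed_upd mulr_sumr; apply: eq_bigr => a _.
by rewrite -updC 1?eq_sym //; ring.
Qed.

Lemma mixed_points (d : 'I_n -> 'I_N) : mixed (fun i => point_mass (d i)) = `|\det (frame d)|.
Proof.
rewrite /mixed (bigD1 [ffun i => d i]) //= [X in _ + X]big1 ?addr0 => [|a ad].
  rewrite big1 => [|i _]; last by rewrite /point_mass ffunE eqxx.
  by rewrite mul1r; congr `|\det _|; apply/matrixP => k l; rewrite !mxE ffunE.
have [i ai] : exists i, a i != d i.
  apply/existsP; apply: contraNT ad => /existsPn ad.
  by apply/eqP/ffunP => i; rewrite ffunE; apply/eqP; have := ad i; rewrite negbK.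
by rewrite (bigD1 i) //= /point_mass (negPf ai) !mul0r.
Qed.

(* The slots outside [S] and [{i, j}] carry point masses; the induction is on [#|S|]. *)
Lemma mixed_lorentzian_slots (S : {set 'I_n}) X (d : 'I_n -> 'I_N) i j :
    i != j -> i \notin S -> j \notin S ->
    (forall k, k \in S -> forall b, 0 < X k b) ->
    (forall k, k \notin S -> k != i -> k != j -> X k = point_mass (d k)) ->
  lorentzian (fun a b => mixed (upd (upd X i (point_mass a)) j (point_mass b))).
Proof.
have [m] := ubnP #|S|; elim: m S X d => // m IHm S X d Sm ij iS jS XS XnS.
(* If [S] is empty, all slots but [i] and [j] hold fixed vectors and the kernel is the absolute
   value of a determinant in two of its rows. Otherwise a slot [k] of [S] is expanded into point
   masses. *)
have [S0|[k kS]] := set_0Vmem S.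
  have -> : (fun a b => mixed (upd (upd X i (point_mass a)) j (point_mass b))) =
      (fun a b => `|\det (set_row (set_row (frame d) i (v a)) j (v b))|).
    apply/funext => a; apply/funext => b; rewrite -!frame_upd -mixed_points.
    congr mixed; apply/funext => k; rewrite /upd.
    case: eqVneq => // kj; case: eqVneq => // ki.
    by rewrite XnS // S0 inE.
  apply: plucker_lorentzian => [a b|a b c e]; first exact: det_row_swap.
  exact: plucker.
have ki : k != i by apply: contraNneq iS => <-.
have kj : k != j by apply: contraNneq jS => <-.
have ik : i != k by rewrite eq_sym.
have jk : j != k by rewrite eq_sym.
pose T a b c := mixed (upd (upd (upd X i (point_mass a)) j (point_mass b)) k (point_mass c)).
pose A a b := mixed (upd (upd X i (point_mass a)) j (point_mass b)).
have AE a b : A a b = \sum_c X k c * T a b c.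
  rewrite -mixed_upd; congr mixed; apply/funext => l; rewrite /upd.
  by case: (eqVneq l k) => // ->; rewrite (negPf kj) (negPf ki).
rewrite -/A; have -> : A = (fun a b => \sum_c X k c * T a b c).
  by apply/funext => a; apply/funext => b; exact: AE.
have X0 l b : l != i -> l != j -> 0 <= X l b.
  move=> li lj; have [lS|lS] := boolP (l \in S); first by rewrite ltW // XS.
  by rewrite XnS // /point_mass ler0n.
have pt0 (a b : 'I_N) : 0 <= point_mass a b by rewrite /point_mass ler0n.
have T0 a b c : 0 <= T a b c.
  apply: mixed_ge0 => l e; rewrite /upd.
  by case: eqVneq => // ?; case: eqVneq => // ?; case: eqVneq => // ?; rewrite X0.
have TE a b c : T a b c = mixed (upd (upd (upd X k (point_mass c)) i (point_mass a)) j (point_mass b)).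
  by rewrite /T (updC _ _ _ jk) (updC _ _ _ ik).
(* Positivity of an entry means that a basis can be chosen from the vectors allowed in the slots,
   with [a] in slot [i] and [b] in slot [j]. *)
have AP a b : 0 < A a b <-> exists e : 'I_n -> 'I_N, [/\ e i = a, e j = b, \det (frame e) != 0 &
    forall l, l != i -> l != j -> 0 < X l (e l)].
  have U0 l b' : 0 <= upd (upd X i (point_mass a)) j (point_mass b) l b'.
    by rewrite /upd; case: eqVneq => // ?; case: eqVneq => // ?; rewrite X0.
  rewrite mixed_gt0P //; split => [[e epos de]|[e [ei ej de epos]]]; exists e => //.
    split => //.
    - have := epos i; rewrite /upd (negPf ij) eqxx /point_mass.
      by case: eqP => //; rewrite ltxx.
    - by have := epos j; rewrite /upd eqxx /point_mass; case: eqP => //; rewrite ltxx.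
    - by move=> l li lj; have := epos l; rewrite /upd (negPf li) (negPf lj).
  move=> l; rewrite /upd; case: (eqVneq l j) => [->|lj].
    by rewrite ej /point_mass eqxx ltr01.
  case: (eqVneq l i) => [->|li]; last exact: epos.
  by rewrite ei /point_mass eqxx ltr01.
apply: lorentzian_tensor => //.
- exact: XS.
- by move=> a b c; rewrite !TE mixed_swap.
- by move=> a b c; rewrite /T mixed_swap.
- move=> c.
  have -> : (fun a b => T a b c) = (fun a b =>
      mixed (upd (upd (upd X k (point_mass c)) i (point_mass a)) j (point_mass b))).
    by apply/funext => a; apply/funext => b; exact: TE.
  (* Each slice has a point mass in slot [k], so the induction hypothesis applies to [S] without
     [k]. *)
  apply: (IHm (S :\ k) _ (upd d k c)) => //.
  + by rewrite (cardsD1 k S) kS in Sm.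
  + by rewrite !inE negb_and iS orbT.
  + by rewrite !inE negb_and jS orbT.
  + by move=> l; rewrite !inE /upd => /andP[/negPf -> lS]; exact: XS.
  + move=> l; rewrite !inE negb_and negbK /upd; case: (eqVneq l k) => //= _ lS li lj.
    exact: XnS.
move=> a b [t +] [t' +]; rewrite -!AE => /AP[e [ei ej de epos]] /AP[c [ci cj dc cpos]].
(* An exchange argument: [e] is a basis with [a] in slot [i], and [c] one with [b] there. If [v b]
   were spanned by the rows of [e] in the slots with a point mass, which are also rows of [c], then
   [c] would be dependent. So [v b] can replace a row of [e] in some slot [l] of [S], or in slot [i]
   or [j]. *)
have [l lS dl] : exists2 l, (l \in S) || (l == i) || (l == j)
    & \det (set_row (frame e) l (v b)) != 0.
  apply/exists2P; apply: contraPP dc => /forallNP H; apply/negP; rewrite negbK.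
  have -> : frame c = set_row (frame c) i (v b).
    by rewrite -ci -frame_upd upd_id.
  rewrite (cramer_row (v b) de) det_set_row_sum big1 // => l _.
  have [lS|] := boolP ((l \in S) || (l == i) || (l == j)).
    have : \det (set_row (frame e) l (v b)) = 0.
      by apply/eqP/negPn/negP => dl; apply: (H l).
    by move=> ->; rewrite !mul0r.
  rewrite !negb_or => /andP[/andP[lS li] lj].
  have pE (f : 'I_n -> 'I_N) : 0 < X l (f l) -> f l = d l.
    by rewrite XnS // /point_mass; case: eqP => //; rewrite ltxx.
  have -> : row l (frame e) = row l (frame c).
    by rewrite !rowK (pE e) ?epos // (pE c) ?cpos.
  by rewrite det_set_row_row ?mulr0.
(* Replacement in slot [i] makes [e j] a common neighbour of [a] and [b]; replacement in slot [j]
   makes [a] and [b] adjacent. *)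
have [li|li] := eqVneq l i.
  right; exists (e j); first by rewrite -AE; apply/AP; exists e.
  rewrite -AE; apply/AP; exists (upd e i b); split.
  - by rewrite /upd eqxx.
  - by rewrite /upd eq_sym (negPf ij).
  - by rewrite frame_upd -li.
  - by move=> l' li' lj'; rewrite /upd (negPf li'); exact: epos.
left; have [lj|lj] := eqVneq l j.
  apply/AP; exists (upd e j b); split.
  - by rewrite /upd (negPf ij).
  - by rewrite /upd eqxx.
  - by rewrite frame_upd -lj.
  - by move=> l' li' lj'; rewrite /upd (negPf lj'); exact: epos.
rewrite (negPf li) (negPf lj) !orbF in lS.
(* For [l] in [S] every vector is allowed in slot [l], so [e j] moves there and leaves slot [j] to
   [b]; up to sign the determinant is that of the replacement. *)
apply/AP; exists (upd (upd e l (e j)) j b); split.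
- by rewrite /upd (negPf ij) eq_sym (negPf li).
- by rewrite /upd eqxx.
- rewrite !frame_upd det_row_swap // -!frame_upd oppr_eq0.
  by rewrite updC // upd_id frame_upd.
- move=> l' li' lj'; rewrite /upd (negPf lj'); case: eqP => [->|_]; first exact: XS.
  exact: epos.
Qed.
End MixedVolume.

(** * Minkowski's first inequality and supporting hyperplanes *)

Section MinkowskiFirstInequality.
Variables (R : realType) (n N : nat) (v : 'I_N -> 'rV[R]_n).
Implicit Types (x y : 'I_N -> R).

Lemma exprn_powR_inv (m : nat) (p : R) : (0 < m)%N -> 0 <= p ->
  (p `^ m%:R^-1) ^+ m = p.
Proof.
move=> m0 p0; rewrite -powR_mulrn ?powR_ge0 // -powRrM mulVf ?powRr1 //.
by rewrite pnatr_eq0 -lt0n.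
Qed.

Lemma powR_inv_exprn (m : nat) (p : R) : (0 < m)%N -> 0 <= p ->
  (p ^+ m) `^ m%:R^-1 = p.
Proof.
move=> m0 p0; rewrite -powR_mulrn // -powRrM mulfV ?powRr1 //.
by rewrite pnatr_eq0 -lt0n.
Qed.

(** Log-concavity makes the ratios of consecutive terms nonincreasing, so each is at most the first
    one. *)
Lemma log_concave_power_mean (a : nat -> R) (m : nat) :
    (forall k, (k <= m)%N -> 0 < a k) ->
    (forall k, (k.+2 <= m)%N -> a k * a k.+2 <= a k.+1 ^+ 2) ->
  forall k, (k <= m)%N -> a k <= a 0%N * (a 1%N / a 0%N) ^+ k.
Proof.
move=> a0 lc; pose r := a 1%N / a 0%N.
have step k : (k.+1 <= m)%N -> a k.+1 <= r * a k.
  elim: k => [|k IHk] km; first by rewrite divfK // gt_eqF ?a0.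
  have ak : 0 < a k by rewrite a0 // ltnW // ltnW.
  have ak1 : 0 < a k.+1 by rewrite a0 // ltnW.
  rewrite -(ler_pM2l ak); apply: le_trans (lc _ km) _.
  by rewrite expr2 mulrA ler_pM2r // mulrC IHk // ltnW.
elim=> [|k IHk] km; first by rewrite expr0 mulr1.
apply: le_trans (step _ km) _; rewrite exprS mulrCA ler_wpM2l ?IHk ?(ltnW km) //.
by rewrite divr_ge0 // ltW // a0 // (leq_trans _ km).
Qed.

(** Let [a k] have [y] in the first [k] slots and [x] in the others. The Alexandrov-Fenchel
    inequality in the slots numbered [k] and [k.+1], counted from 0, makes this sequence
    log-concave, and its last term is compared with the first two. *)
Lemma mixed_minkowski (n_gt0 : (0 < n)%N) x y :
    (forall b, 0 < x b) -> (forall b, 0 < y b) -> 0 < mixed v (fun=> x) ->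
  mixed v (fun=> y) <= mixed v (fun=> x) *
    (mixed v (upd (fun=> x) (Ordinal n_gt0) y) / mixed v (fun=> x)) ^+ n.
Proof.
move=> x0 y0 mx.
pose a k := mixed v (fun l : 'I_n => if (l < k)%N then y else x).
have E0 : mixed v (fun=> x) = a 0%N by [].
have En : mixed v (fun=> y) = a n.
  by congr mixed; apply/funext => l; rewrite ltn_ord.
have E1 : mixed v (upd (fun=> x) (Ordinal n_gt0) y) = a 1%N.
  by congr mixed; apply/funext => l; rewrite /upd -val_eqE /= ltnS leqn0.
rewrite En E1 E0; apply: (log_concave_power_mean (m := n)) => // k kn.
  have [|e _ de] := (mixed_gt0P v (X := fun=> x) _).1 mx; first by move=> *; rewrite ltW.
  apply/mixed_gt0P; first by move=> l b; case: ifP; rewrite ltW.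
  by exists e => // l; case: ifP.
have ak0 : 0 < a k.+2.
  have [|e _ de] := (mixed_gt0P v (X := fun=> x) _).1 mx; first by move=> *; rewrite ltW.
  apply/mixed_gt0P; first by move=> l b; case: ifP; rewrite ltW.
  by exists e => // l; case: ifP.
pose i := Ordinal (ltnW kn); pose j := Ordinal kn.
have ij : i != j by rewrite -val_eqE /= ltn_eqF.
pose X (l : 'I_n) := if (l < k)%N then y else x.
have F z t : mixed v (upd (upd X i z) j t) = mixed v (fun l : 'I_n =>
    if (l < k)%N then y else if l == k :> nat then z else if l == k.+1 :> nat then t else x).
  congr mixed; apply/funext => l; rewrite /upd /X -!val_eqE /=.
  case: (ltngtP l k) => [lk|lk|->] //; first by rewrite ltn_eqF // leqW.
  by rewrite ltn_eqF.
have [|d0 _ _] := (mixed_gt0P v (X := fun=> x) _).1 mx; first by move=> *; rewrite ltW.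
have LF := @mixed_lorentzian_slots R n N v (~: [set i; j]) X d0 i j ij.
have {}LF : lorentzian (fun a b => mixed v (upd (upd X i (point_mass R a)) j (point_mass R b))).
  apply: LF.
  - by rewrite !inE eqxx.
  - by rewrite !inE eqxx orbT.
  - by move=> l _ b; rewrite /X; case: ifP.
  - by move=> l; rewrite !inE negbK => /orP[] ->.
have cases (l : 'I_n) (z t : 'I_N -> R) m : z = (if (k < m)%N then y else x) ->
   t = (if (k.+1 < m)%N then y else x) -> (k <= m <= k.+2)%N ->
   (if (l < k)%N then y else if l == k :> nat then z else if l == k.+1 :> nat then t else x)
   = (if (l < m)%N then y else x).
  move=> -> -> /andP[km mk]; case: (ltngtP l k) => [lk|lk|->] //.
    by rewrite (leq_trans lk km).
  case: eqP => [-> //|/eqP lk1]; rewrite ltnNge (leq_trans mk) //.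
  by rewrite ltn_neqAle eq_sym lk1.
have a2 : mixed v (upd (upd X i y) j y) = a k.+2.
  rewrite F /a; congr mixed; apply/funext => l.
  by rewrite (cases l y y k.+2) ?ltnSn ?ltnS ?leqnSn ?leqnn // ltnW.
have a1 : mixed v (upd (upd X i x) j y) = a k.+1.
  rewrite mixed_swap // F /a; congr mixed; apply/funext => l.
  by rewrite (cases l y x k.+1) ?ltnSn ?ltnn ?leqnSn.
have a00 : mixed v (upd (upd X i x) j x) = a k.
  rewrite F /a; congr mixed; apply/funext => l.
  by rewrite (cases l x x k) ?ltnn ?[(k.+1 < k)%N]ltnNge ?leqnSn ?leqnn //= ltnW // ltnW.
by have := LF x y; rewrite !bil_mixed // a1 a2 a00; exact.
Qed.

(* The supporting hyperplane at [x] of the concave function [y |-> mixed (fun=> y) `^ n%:R^-1]. *)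
Lemma mixed_support (n_gt0 : (0 < n)%N) x : (forall b, 0 < x b) ->
  exists c : 'I_N -> R, [/\ forall b, 0 <= c b,
    forall y, (forall b, 0 < y b) -> mixed v (fun=> y) `^ n%:R^-1 <= \sum_b c b * y b
    & mixed v (fun=> x) `^ n%:R^-1 = \sum_b c b * x b].
Proof.
move=> x0; have ge0 y : (forall b, 0 < y b) -> 0 <= mixed v (fun=> y).
  by move=> y0; apply: mixed_ge0 => *; rewrite ltW.
(* At positive weights the value is zero only if no [n] of the vectors are independent; it then
   vanishes at all positive weights, and the zero form supports it. *)
have [m0|m0] := eqVneq (mixed v (fun=> x)) 0.
  exists (fun=> 0); split=> // [y y0|]; rewrite big1 ?m0 ?powR0 ?invr_eq0 ?pnatr_eq0 -?lt0n //;
    do ?[by move=> *; rewrite mul0r].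
  have -> : mixed v (fun=> y) = 0; last by rewrite powR0 ?invr_eq0 ?pnatr_eq0 -?lt0n.
  apply/eqP; rewrite eq_le ge0 // andbT leNgt; apply/negP => /mixed_gt0P[].
    by move=> *; rewrite ltW.
  move=> e _ de; have : 0 < mixed v (fun=> x); last by rewrite m0 ltxx.
  by apply/mixed_gt0P; [move=> *; rewrite ltW | exists e].
have {m0}p0 : 0 < mixed v (fun=> x) by rewrite lt_def m0 ge0.
set p := mixed v (fun=> x) in p0 *; pose r := p `^ n%:R^-1.
have r0 : 0 < r by rewrite powR_gt0.
have rn : r ^+ n = p by rewrite exprn_powR_inv // ltW.
(* By symmetry of the slots, [n * mb b] is the partial derivative of the volume polynomial in the
   weight [b], so [mb b / p * r] is that of its [n]-th root at [x]. *)
pose mb b := mixed v (upd (fun=> x) (Ordinal n_gt0) (point_mass R b)).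
have mb0 b : 0 <= mb b.
  by apply: mixed_ge0 => l b'; rewrite /upd; case: eqP => _; [rewrite /point_mass ler0n | exact: ltW].
have sumE y : \sum_b mb b / p * r * y b = mixed v (upd (fun=> x) (Ordinal n_gt0) y) / p * r.
  rewrite (mixed_upd _ _ _ y) !mulr_suml; apply: eq_bigr => b _; rewrite -/(mb b); ring.
exists (fun b => mb b / p * r); split.
- by move=> b; rewrite mulr_ge0 ?divr_ge0 ?mb0 // ltW.
- move=> y y0; rewrite sumE; set X := mixed v (upd _ _ y) / p * r.
  have X0 : 0 <= X.
    apply: mulr_ge0 (ltW r0); apply: divr_ge0 (ltW p0); apply: mixed_ge0 => l b'.
    by rewrite /upd; case: eqP => _; rewrite ltW.
  have le_pX : mixed v (fun=> y) <= X ^+ n.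
    by rewrite exprMn rn mulrC; exact: mixed_minkowski.
  rewrite -[leRHS](@powR_inv_exprn n) //.
  by apply: (@ge0_ler_powR _ n%:R^-1) le_pX; rewrite ?invr_ge0 ?nnegrE ?ge0 ?exprn_ge0.
- have -> : \sum_b mb b / p * r * x b = r; last by [].
  rewrite sumE; have -> : upd (fun=> x) (Ordinal n_gt0) x = fun=> x.
    by apply/funext => l; rewrite /upd; case: eqP.
  by rewrite -/p divff ?mul1r // gt_eqF.
Qed.
End MinkowskiFirstInequality.

(** * Harmonic functions and the maximum principle *)

Section SecondDifferences.
Variables (R : realType) (m : nat).
Implicit Types (f u : 'rV[R]_m -> R) (x e : 'rV[R]_m).

Lemma is_derive_line f x e (t : R) : derivable f (x + t *: e) e ->
  is_derive t (1 : R) (fun s : R => f (x + s *: e)) ('D_e f (x + t *: e)).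
Proof.
move=> df.
have E : (fun h : R => h^-1 *: (((fun s : R => f (x + s *: e)) \o shift t) (h *: (1 : R)) -
      f (x + t *: e))) =
    (fun h => h^-1 *: ((f \o shift (x + t *: e)) (h *: e) - f (x + t *: e))).
  apply/funext => h /=; congr (_ *: (f _ - _)).
  by rewrite scaler1 scalerDl addrCA addrC.
by split; [rewrite /derivable E | rewrite /derive E].
Qed.

(** The mean value theorem is applied to [f (x + t e) + f (x - t e) - l t ^+ 2]. Its derivative is a
    difference of first derivatives minus [2 l t], which is of smaller order than [t] because the
    first derivative is itself derivable at [x]. *)
Lemma second_difference (U : set 'rV[R]_m) f x e :
    open U -> U x -> (forall y, U y -> differentiable f y) ->
    derivable ('D_e f) x e -> forall eps : R, 0 < eps ->
  \forall s \near 0^'+, `|f (x + s *: e) + f (x - s *: e) - 2 * f x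
     - s ^+ 2 * 'D_e ('D_e f) x| <= eps * s ^+ 2.
Proof.
move=> oU Ux df dp eps eps0; set p := 'D_e f; set l := 'D_e p x.
have Unear : \forall s \near (0 : R), U (x + s *: e).
  have cl : (fun s : R => x + s *: e) @ (0 : R) --> x + 0 *: e.
    by apply: cvgD; [exact: cvg_cst | apply: cvgZr_tmp; exact: cvg_id].
  by apply: cl; rewrite scale0r addr0; exact: open_nbhs_nbhs.
have pnear : \forall h \near (0 : R), `|p (x + h *: e) - p x - h * l| <= eps / 2 * `|h|.
  have e20 : 0 < eps / 2 by rewrite divr_gt0.
  have := dp; rewrite /derivable -/p => /cvgrPdist_le /(_ _ e20).
  rewrite near_withinE; apply: filterS => h /= H.
  have [->|h0] := eqVneq h 0.
    by rewrite scale0r addr0 subrr mul0r subr0 !normr0 mulr0.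
  have := H h0; rewrite -(ler_pM2r (_ : 0 < `|h|)) ?normr_gt0 // -normrM.
  congr (_ <= _); rewrite distrC -/p -/l; congr `|_|.
  have sc (z : R) : (l - h^-1 *: z) * h = h * l - z.
    by rewrite -[h^-1 *: z]/(h^-1 * z); field.
  by rewrite (addrC (h *: e)); exact: sc.
have /nbhs_norm0P[d1 /= d10 Ud] := Unear; have /nbhs_norm0P[d2 /= d20 pd] := pnear.
near=> s.
have s0 : 0 < s by near: s; exact: nbhs_right_gt.
have sd1 : s < d1 by near: s; apply: nbhs_right_lt.
have sd2 : s < d2 by near: s; apply: nbhs_right_lt.
have line_d (t : R) : `|t| <= s -> is_derive t (1 : R) (fun r : R => f (x + r *: e)) (p (x + t *: e)).
  by move=> ts; apply: is_derive_line; apply/diff_derivable/df/Ud; exact: le_lt_trans ts sd1.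
have line_dN (t : R) : `|t| <= s ->
    is_derive t (1 : R) (fun r : R => f (x + r *: - e)) (- p (x + (- t) *: e)).
  move=> ts; have Uy : U (x + (- t) *: e) by apply: Ud => /=; rewrite normrN (le_lt_trans ts).
  have dy := df _ Uy; rewrite scaleNr -scalerN in Uy dy *.
  have -> : - p (x + t *: - e) = 'D_(- e) f (x + t *: - e).
    by rewrite /p (deriveE _ dy) (deriveE _ dy); exact/esym/linearN.
  by apply: is_derive_line; exact: diff_derivable.
pose k := fun t : R => f (x + t *: e) + f (x + t *: - e) - l * t ^+ 2.
have kd t : `|t| <= s -> is_derive t (1 : R) k (p (x + t *: e) - p (x + (- t) *: e) - l * (2 * t)).
  move=> ts; have := line_d _ ts; have := line_dN _ ts => h1 h2.
  have h3 : is_derive t (1 : R) (fun t : R => l * t ^+ 2) (l * (2 * t)).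
    apply: (is_derive_eq (is_deriveZ l (is_deriveX 2 (is_derive_id t (1 : R))))).
    by rewrite /= -[_ *: _]/(_ * _) -[X in _ * X]/(_ * _) mulr1.
  by have := is_deriveB (is_deriveD h2 h1) h3.
have cont_k : {within `[0, s], continuous k}.
  apply: derivable_within_continuous => t; rewrite in_itv /= => /andP[t0 ts].
  by have [] := kd t _; rewrite ?ger0_norm.
have kd' t : t \in `]0, s[ ->
    is_derive t (1 : R) k (p (x + t *: e) - p (x + (- t) *: e) - l * (2 * t)).
  rewrite in_itv /= => /andP[t0 ts]; apply: kd.
  by rewrite ger0_norm ltW.
have [c] := MVT s0 kd' cont_k.
rewrite in_itv /= => /andP[c0 cs]; rewrite /k !scale0r !addr0 expr0n /= mulr0 !subr0 scalerN => E.
have -> : f (x + s *: e) + f (x - s *: e) - 2 * f x - s ^+ 2 * l =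
  (p (x + c *: e) - p (x + (- c) *: e) - l * (2 * c)) * s.
  by rewrite -E; ring.
have pc : `|p (x + c *: e) - p x - c * l| <= eps / 2 * c.
  by have := pd c; rewrite /= (gtr0_norm c0); apply; exact: lt_trans cs sd2.
have pNc : `|p (x + (- c) *: e) - p x - (- c) * l| <= eps / 2 * c.
  by have := pd (- c); rewrite /= normrN (gtr0_norm c0); apply; exact: lt_trans cs sd2.
rewrite normrM (gtr0_norm s0) expr2 mulrA ler_pM2r //.
apply: (@le_trans _ _ (eps * c)); last by rewrite ler_pM2l // ltW.
have -> : p (x + c *: e) - p (x + (- c) *: e) - l * (2 * c) =
   (p (x + c *: e) - p x - c * l) - (p (x + (- c) *: e) - p x - (- c) * l) by ring.
apply: (le_trans (ler_normB _ _)); apply: (le_trans (lerD pc pNc)).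
lra.
Unshelve. all: by end_near. Qed.
End SecondDifferences.

Section MaximumPrinciple.
Variables (R : realType) (m : nat).
Implicit Types (u w : 'rV[R]_m -> R) (x y : 'rV[R]_m) (s : R).
Local Notation e j := (@basis_vec R m j).

Definition axis_diff2 u x s : R :=
  \sum_j (u (x + s *: e j) + u (x - s *: e j) - 2 * u x).

(* A derivative-free form of [laplacian u x = 0]: it passes to reflections of [u] at once. *)
Definition diff_harmonic u x :=
  forall eps : R, 0 < eps -> \forall s \near 0^'+, `|axis_diff2 u x s| <= eps * s ^+ 2.

Lemma harmonic_diff_harmonic (U : set 'rV[R]_m) u x :
  open U -> harmonic_on U u -> U x -> diff_harmonic u x.
Proof.
move=> oU [[du dpu] lap] Ux eps eps0.
(* The sum of [m] errors stays below [eps]; the divisor [m.+1] is nonzero also when [m] is 0. *)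
have e0 : 0 < eps / m.+1%:R by rewrite divr_gt0 ?ltr0n.
have H : \forall s \near 0^'+, forall j, `|u (x + s *: e j) + u (x - s *: e j) - 2 * u x
     - s ^+ 2 * 'D_(e j) ('D_(e j) u) x| <= eps / m.+1%:R * s ^+ 2.
  apply: filter_forall => j; apply: (second_difference oU Ux du) => //.
  by have [dp _] := dpu j; apply/diff_derivable/dp.
apply: filterS H => s H.
have -> : axis_diff2 u x s = \sum_j (u (x + s *: e j) + u (x - s *: e j) - 2 * u x
     - s ^+ 2 * 'D_(e j) ('D_(e j) u) x).
  by rewrite sumrB -mulr_sumr (lap x Ux : \sum_j _ = 0) mulr0 subr0.
apply: (le_trans (ler_norm_sum _ _ _)); apply: (le_trans (ler_sum _ (fun j _ => H j))).
rewrite sumr_const card_ord -[_ *+ m]mulr_natr mulrAC ler_wpM2r ?sqr_ge0 //.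
by rewrite -mulrA ler_piMr ?(ltW eps0) // mulrC ler_pdivrMr ?ltr0n // mul1r ler_nat.
Qed.

Lemma axis_diff2D u w (c : R) x s : axis_diff2 (fun y => u y + c * w y) x s =
  axis_diff2 u x s + c * axis_diff2 w x s.
Proof.
by rewrite /axis_diff2 mulr_sumr -big_split; apply: eq_bigr => j _ /=; ring.
Qed.

Lemma diff_harmonicD u w (c : R) x :
  diff_harmonic u x -> diff_harmonic w x -> diff_harmonic (fun y => u y + c * w y) x.
Proof.
move=> hu hw eps eps0; have c0 : 0 < `|c| + 1 by rewrite ltr_wpDl.
have e1 : 0 < eps / 2 by rewrite divr_gt0.
have e2 : 0 < eps / 2 / (`|c| + 1) by rewrite divr_gt0.
near=> s; rewrite axis_diff2D; apply: (le_trans (ler_normD _ _)).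
have H1 : `|axis_diff2 u x s| <= eps / 2 * s ^+ 2 by near: s; exact: hu.
have H2 : `|axis_diff2 w x s| <= eps / 2 / (`|c| + 1) * s ^+ 2 by near: s; exact: hw.
rewrite normrM.
have : `|c| * `|axis_diff2 w x s| <= eps / 2 * s ^+ 2; last by lra.
apply: (@le_trans _ _ ((`|c| + 1) * `|axis_diff2 w x s|)).
  by rewrite ler_wpM2r // lerDl.
by rewrite mulrC -ler_pdivlMr // mulrAC.
Unshelve. all: by end_near. Qed.

Lemma coord_shift x s j i : (x + s *: e j) 0 i = x 0 i + (i == j)%:R * s.
Proof. by rewrite !mxE eqxx /= mulrC. Qed.

Lemma coord_shiftN x s j i : (x - s *: e j) 0 i = x 0 i - (i == j)%:R * s.
Proof. by rewrite !mxE eqxx /= mulrC. Qed.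

Definition sqnorm x : R := \sum_i x 0 i ^+ 2.

Lemma sqnorm_ge0 x : 0 <= sqnorm x.
Proof. by apply: sumr_ge0 => i _; rewrite sqr_ge0. Qed.

Lemma axis_diff2_sqnorm x s : axis_diff2 sqnorm x s = 2 * m%:R * s ^+ 2.
Proof.
rewrite /axis_diff2 (eq_bigr (fun=> 2 * s ^+ 2)) => [|j _].
  by rewrite sumr_const card_ord -mulr_natr; ring.
rewrite /sqnorm mulr_sumr -big_split -sumrB /= (bigD1 j) //= big1 ?addr0.
  by rewrite coord_shift coord_shiftN eqxx /=; ring.
by move=> i /negPf ij; rewrite coord_shift coord_shiftN ij /=; ring.
Qed.

Lemma sqnorm_continuous : continuous sqnorm.
Proof.
apply: (continuous_big (@add_continuous _)) => i _ x.
by apply: (@continuous_comp _ _ _ (fun x : 'rV[R]_m => x 0 i) (fun z : R => z ^+ 2));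
  [exact: coord_continuous | exact: exprn_continuous].
Qed.

Lemma within_continuousD (K : set 'rV[R]_m) u w (c : R) :
  {within K, continuous u} -> {within K, continuous w} ->
  {within K, continuous (fun y => u y + c * w y)}.
Proof. move=> cu cw y; exact: (cvgD (cu y) (cvgM (cvg_cst c) (cw y))). Qed.

(** Adding [eps * sqnorm] makes the second differences of [u] strictly positive at the points of the
    second kind, so the maximum over [K] is at a point where [u <= 0]. Then [eps] tends to 0. *)
Lemma maximum_principle (K : set 'rV[R]_m) u : (0 < m)%N -> compact K ->
    {within K, continuous u} ->
    (forall x, K x -> u x <= 0 \/
      diff_harmonic u x /\ \forall s \near 0^'+, forall j, K (x + s *: e j) /\ K (x - s *: e j)) ->
  forall x, K x -> u x <= 0.
Proof.
move=> m0 cK cu H x0 Kx0.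
have K0 : K !=set0 by exists x0.
have [b _ bmax] := compact_EVT_max K0 cK (continuous_subspaceT sqnorm_continuous).
have main (eps : R) : 0 < eps -> u x0 <= eps * sqnorm b.
  move=> eps0; pose w y := u y + eps * sqnorm y.
  have cw : {within K, continuous w}.
    by apply: within_continuousD => //; exact/continuous_subspaceT/sqnorm_continuous.
  have [z /set_mem Kz zmax] := compact_EVT_max K0 cK cw.
  have [uz|[hz nz]] := H z Kz.
    have := zmax x0 (mem_set Kx0); rewrite /w => x0z.
    have : eps * sqnorm z <= eps * sqnorm b by rewrite ler_pM2l // bmax // inE.
    have : 0 <= eps * sqnorm x0.
      by rewrite mulr_ge0 ?sqnorm_ge0 ?ltW.
    by lra.
  exfalso; near (0 : R)^'+ => s.
  have s0 : 0 < s by near: s; exact: nbhs_right_gt.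
  have Ks : forall j, K (z + s *: e j) /\ K (z - s *: e j) by near: s; exact: nz.
  have hs : `|axis_diff2 u z s| <= eps * s ^+ 2 by near: s; exact: hz.
  have : axis_diff2 w z s <= 0.
    rewrite -oppr_ge0 /axis_diff2 -sumrN sumr_ge0 // => j _; have [K1 K2] := Ks j.
    by have := zmax _ (mem_set K1); have := zmax _ (mem_set K2); lra.
  rewrite axis_diff2D axis_diff2_sqnorm.
  (* The gain from [sqnorm] exceeds the allowed error in [u], as [2 * m] is at least 2. *)
  have : eps * s ^+ 2 < eps * (2 * m%:R * s ^+ 2).
    rewrite ltr_pM2l // ltr_pMl ?exprn_gt0 //.
    have : (1 : R) <= m%:R by rewrite (ler_nat _ 1).
    by lra.
  by move: hs; rewrite ler_norml => /andP[]; lra.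
have sb0 := sqnorm_ge0 b.
apply/ler_addgt0Pr => eps eps0; rewrite add0r.
apply: (le_trans (main (eps / (sqnorm b + 1)) _)); first by rewrite divr_gt0 // ltr_wpDl.
rewrite mulrAC ler_pdivrMr ?ltr_wpDl //; nra.
Unshelve. all: by end_near. Qed.
End MaximumPrinciple.

(** * Interior estimate on cubes for bounded harmonic functions *)

Section InteriorEstimate.
Variables (R : realType) (m : nat).
Implicit Types (u w : 'rV[R]_m -> R) (p x y : 'rV[R]_m) (s d t : R) (i j : 'I_m).
Local Notation e j := (@basis_vec R m j).

Definition cube p d : set 'rV[R]_m := [set y | forall j, `|y 0 j - p 0 j| <= d].

Lemma cube_compact p d : compact (cube p d).
Proof.
have -> : cube p d = [set y | forall j, `[p 0 j - d, p 0 j + d]%classic (y ord0 j)].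
  by apply/seteqP; split=> y /= H j; have := H j; rewrite /= in_itv /= ler_distl.
by apply: (@rV_compact _ _ (fun j => `[p 0 j - d, p 0 j + d]%classic)) => j; exact: segment_compact.
Qed.

Definition reflection p i y := y - (2 * (y 0 i - p 0 i)) *: e i.

Lemma reflectionE p i y j :
  reflection p i y 0 j = if j == i then 2 * p 0 i - y 0 i else y 0 j.
Proof. by rewrite coord_shiftN; case: eqP => [->|_] /=; ring. Qed.

Lemma cube_reflection p d i y : cube p d y -> cube p d (reflection p i y).
Proof.
move=> Ky j; rewrite reflectionE; case: eqP => [->|//].
by have := Ky i; rewrite -normrN; congr (_ <= _); congr `|_|; ring.
Qed.

Lemma axis_diff2_reflection u p i y s :
  axis_diff2 (u \o reflection p i) y s = axis_diff2 u (reflection p i y) s.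
Proof.
apply: eq_bigr => j _ /=.
have [->|ji] := eqVneq j i.
  have -> : reflection p i (y + s *: e i) = reflection p i y - s *: e i.
    apply/rowP => k; rewrite coord_shiftN !reflectionE !coord_shift eqxx.
    by case: eqP => _ /=; ring.
  have -> : reflection p i (y - s *: e i) = reflection p i y + s *: e i.
    apply/rowP => k; rewrite coord_shift !reflectionE !coord_shiftN eqxx.
    by case: eqP => _ /=; ring.
  by congr (_ - _); rewrite addrC.
have -> : reflection p i (y + s *: e j) = reflection p i y + s *: e j.
  apply/rowP => k; rewrite coord_shift !reflectionE !coord_shift.
  by case: (eqVneq k i) => [->|_] //; rewrite eq_sym (negPf ji) /=; ring.
have -> // : reflection p i (y - s *: e j) = reflection p i y - s *: e j.
apply/rowP => k; rewrite coord_shiftN !reflectionE !coord_shiftN.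
by case: (eqVneq k i) => [->|_] //; rewrite eq_sym (negPf ji) /=; ring.
Qed.

Lemma diff_harmonic_reflection u p i y :
  diff_harmonic u (reflection p i y) -> diff_harmonic (u \o reflection p i) y.
Proof.
move=> hu eps eps0; apply: filterS (hu _ eps0) => s.
by rewrite axis_diff2_reflection.
Qed.

(* On the half cube [p 0 i <= y 0 i] this is nonnegative, and at least [d ^+ 2] on the faces
   other than [y 0 i = p 0 i]. *)
Definition barrier p d i y : R :=
  sqnorm (y - p) + m%:R * (d * (y 0 i - p 0 i) - (y 0 i - p 0 i) ^+ 2).

(** The second differences cancel exactly: [2 m s ^+ 2] from [sqnorm] against the concave term in
    the coordinate [i]. *)
Lemma diff_harmonic_barrier p d i y : diff_harmonic (barrier p d i) y.
Proof.
move=> eps eps0; apply: filterS (nbhs_right_gt 0) => s _.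
rewrite axis_diff2D.
have -> : axis_diff2 (fun y => sqnorm (y - p)) y s = axis_diff2 (@sqnorm R m) (y - p) s.
  by apply: eq_bigr => j _; rewrite [y + _ - p]addrAC [y - _ - p]addrAC.
rewrite axis_diff2_sqnorm.
have -> : axis_diff2 (fun y => d * (y 0 i - p 0 i) - (y 0 i - p 0 i) ^+ 2) y s = - 2 * s ^+ 2.
  rewrite /axis_diff2 (bigD1 i) //= big1 ?addr0.
    by rewrite coord_shift coord_shiftN eqxx /=; ring.
  by move=> j /negPf ji; rewrite coord_shift coord_shiftN eq_sym ji /=; ring.
have -> : 2 * m%:R * s ^+ 2 + m%:R * (- 2 * s ^+ 2) = 0 by ring.
by rewrite normr0 mulr_ge0 ?sqr_ge0 // ltW.
Qed.

Lemma barrier_continuous p d i : continuous (barrier p d i).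
Proof.
have cz : continuous (fun y => y 0 i - p 0 i).
  by move=> y; exact: (cvgB (@coord_continuous R 1 m 0 i y) (cvg_cst _)).
have cs : continuous (fun y => sqnorm (y - p)).
  move=> y; apply: (@continuous_comp _ _ _ (fun y => y - p) (@sqnorm R m)).
    exact: (cvgB cvg_id (cvg_cst _)).
  exact: sqnorm_continuous.
move=> y; apply: (cvgD (cs y)); apply: (cvgM (cvg_cst _)).
exact: (cvgB (cvgM (cvg_cst d) (cz y)) (cvgM (cz y) (cz y))).
Qed.

(* Comparing the odd part of [u] across the hyperplane [y 0 i = p 0 i] with the
   barrier on half of the cube bounds differences of [u] without derivatives
   (Gilbarg-Trudinger, Theorem 3.9). *)
Lemma cube_estimate_le u p d i t : 0 < d -> 0 <= t <= d ->
    (forall y, cube p d y -> {for y, continuous u}) ->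
    (forall y, cube p d y -> `|u y| <= 1) ->
    (forall y, (forall j, `|y 0 j - p 0 j| < d) -> diff_harmonic u y) ->
  u (p + t *: e i) - u (p - t *: e i) <= 2 * m%:R / d * t.
Proof.
move=> d0 /andP[t0 td] cu u1 hu.
have m0 : (0 < m)%N by case: (m) i => [[]|].
pose phi y := u y + (-1) * (u \o reflection p i) y.
(* The factor matches [phi <= 2] with the lower bound [d ^+ 2] of the barrier on the outer faces; on
   the hyperplane of reflection [phi] is zero. *)
pose psi y := phi y + (- (2 / d ^+ 2)) * barrier p d i y.
pose K := cube p d `&` [set y | p 0 i <= y 0 i].
have d20 : 0 < 2 / d ^+ 2 by rewrite divr_gt0 ?exprn_gt0.
have sphi y : cube p d y -> phi y <= 2.
  move=> Ky; have := u1 _ Ky; have := u1 _ (cube_reflection i Ky).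
  by rewrite /phi /= !ler_norml => /andP[? ?] /andP[? ?]; lra.
have refl_cts : continuous (reflection p i).
  move=> y; apply: (cvgB cvg_id); apply: cvgZr_tmp; apply: (cvgM (cvg_cst _)).
  exact: (cvgB (@coord_continuous R 1 m 0 i y) (cvg_cst _)).
have reflK : {within K, continuous (u \o reflection p i)}.
  apply: continuous_in_subspaceT => y /set_mem[Ky _].
  apply: continuous_comp; first exact: refl_cts.
  exact/cu/cube_reflection.
have clz : closed [set y : 'rV[R]_m | p 0 i <= y 0 i].
  apply: (@preimage_closed _ _ (fun y : 'rV[R]_m => y 0 i) [set z | p 0 i <= z]).
    by move=> y _; exact: coord_continuous.
  exact: closed_ge.
have cK : compact K := compact_closedI (@cube_compact p d) clz.
have Kp : K (p + t *: e i).
  split=> [j|]; rewrite /= coord_shift ?eqxx /=; last by rewrite mul1r lerDl.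
  rewrite addrAC subrr add0r normrM (ger0_norm t0); case: eqP => _ /=.
    by rewrite normr1 mul1r.
  by rewrite normr0 mul0r ltW.
have : psi (p + t *: e i) <= 0.
  apply: (maximum_principle m0 cK) Kp.
    apply: within_continuousD.
      apply: within_continuousD => //.
      by apply: continuous_in_subspaceT => y /set_mem[Ky _]; exact: cu.
    exact/continuous_subspaceT/barrier_continuous.
  move=> y [Ky /= yi]; have z0 : 0 <= y 0 i - p 0 i by rewrite subr_ge0.
  have zd : y 0 i - p 0 i <= d by have := Ky i; rewrite ger0_norm.
  have bar_ge : sqnorm (y - p) <= barrier p d i y.
    rewrite lerDl mulr_ge0 // subr_ge0 expr2 ler_wpM2r //.
  have [zi0|zi] := eqVneq (y 0 i) (p 0 i).
    left; have -> : psi y = - (2 / d ^+ 2) * barrier p d i y.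
      rewrite /psi /phi /=; have -> : reflection p i y = y.
        by rewrite /reflection zi0 subrr mulr0 scale0r subr0.
      ring.
    rewrite mulNr oppr_le0; apply: mulr_ge0; first exact: ltW.
    exact: le_trans (sqnorm_ge0 _) bar_ge.
  have [/existsP[j /eqP yj]|/existsPn yd] := boolP [exists j, `|y 0 j - p 0 j| == d].
    left; have : d ^+ 2 <= barrier p d i y.
      apply: le_trans bar_ge; rewrite -yj real_normK ?num_real // /sqnorm (bigD1 j) //= !mxE lerDl.
      by apply: sumr_ge0 => k _; rewrite sqr_ge0.
    have := sphi _ Ky; rewrite /psi => h1 h2.
    have : 2 / d ^+ 2 * d ^+ 2 <= 2 / d ^+ 2 * barrier p d i y by rewrite ler_pM2l.
    by rewrite divfK ?expf_neq0 ?gt_eqF //; lra.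
  have {}yd j : `|y 0 j - p 0 j| < d by rewrite lt_neqAle yd Ky.
  (* Off the hyperplane and the outer faces, [psi] is harmonic in the sense of second differences
     and small axis shifts stay in the half cube. *)
  right; split.
    apply: diff_harmonicD; last exact: diff_harmonic_barrier.
    apply: diff_harmonicD; first exact: hu.
    apply: diff_harmonic_reflection; apply: hu => j; rewrite reflectionE.
    case: eqP => [->|//]; have := yd i; rewrite -normrN; congr (_ < _); congr `|_|; ring.
  near=> s => j.
  have s0 : 0 < s by near: s; exact: nbhs_right_gt.
  have sz : s < y 0 i - p 0 i.
    near: s; apply: nbhs_right_lt; rewrite lt_neqAle z0 andbT.
    by rewrite eq_sym subr_eq0.
  have sd : forall k, s < d - `|y 0 k - p 0 k|.
    near: s; apply: filter_forall => k; apply: nbhs_right_lt.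
    by rewrite subr_gt0.
  have b01 k : `|(k == j)%:R * s| <= s.
    by case: eqP => _ /=; rewrite ?mul1r ?mul0r ?normr0 ?gtr0_norm // ltW.
  have tri (b : R) k : `|b| <= s -> `|y 0 k - p 0 k + b| <= d.
    by move=> bs; have := sd k; have := ler_normD (y 0 k - p 0 k) b; lra.
  split; split=> [k|] /=; rewrite ?coord_shift ?coord_shiftN.
  - by rewrite addrAC; exact: tri.
  - have := b01 i; rewrite ler_norml => /andP[]; lra.
  - by rewrite addrAC; apply: (tri (- ((k == j)%:R * s)) k); rewrite normrN.
  - have := b01 i; rewrite ler_norml => /andP[]; lra.
have -> : psi (p + t *: e i) = u (p + t *: e i) - u (p - t *: e i) -
    2 / d ^+ 2 * (t ^+ 2 + m%:R * (d * t - t ^+ 2)).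
  have -> : p - t *: e i = reflection p i (p + t *: e i).
    apply/rowP => j; rewrite reflectionE coord_shiftN !coord_shift eqxx.
    by case: eqP => [->|_] /=; ring.
  rewrite /psi /phi /barrier /= coord_shift eqxx /=.
  have -> : sqnorm (p + t *: e i - p) = t ^+ 2.
    rewrite /sqnorm (bigD1 i) //= big1 => [|j /negPf ji].
      by rewrite !mxE !eqxx /=; ring.
    by rewrite !mxE eqxx ji /=; ring.
  rewrite mul1r; have -> : p 0 i + t - p 0 i = t by ring.
  ring.
have : 2 / d ^+ 2 * (t ^+ 2 + m%:R * (d * t - t ^+ 2)) <= 2 * m%:R / d * t.
  have -> : 2 * m%:R / d * t = 2 / d ^+ 2 * (m%:R * (d * t)) by field; rewrite gt_eqF.
  rewrite ler_pM2l //; have : (1 : R) <= m%:R by rewrite (ler_nat _ 1).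
  have := sqr_ge0 t; nra.
by lra.
Unshelve. all: by end_near. Qed.
End InteriorEstimate.

Section Equicontinuity.
Variables (R : realType) (m : nat).
Implicit Types (u : 'rV[R]_m -> R) (p x y : 'rV[R]_m) (s d t : R) (i j : 'I_m).
Local Notation e j := (@basis_vec R m j).

Lemma cube_estimate u p d i t : 0 < d -> `|t| <= d ->
    (forall y, cube p d y -> {for y, continuous u}) ->
    (forall y, cube p d y -> `|u y| <= 1) ->
    (forall y, (forall j, `|y 0 j - p 0 j| < d) -> diff_harmonic u y) ->
  `|u (p + t *: e i) - u (p - t *: e i)| <= 2 * m%:R / d * `|t|.
Proof.
move=> d0 td cu u1 hu.
have le_abs s : 0 <= s <= d -> `|u (p + s *: e i) - u (p - s *: e i)| <= 2 * m%:R / d * s.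
  move=> sd; rewrite ler_norml cube_estimate_le // andbT lerNl opprB.
  pose w y := 0 + (-1) * u y.
  have : w (p + s *: e i) - w (p - s *: e i) <= 2 * m%:R / d * s.
    apply: cube_estimate_le => //.
    - by move=> y Ky; exact: (cvgD (cvg_cst _) (cvgM (cvg_cst _) (cu y Ky))).
    - by move=> y Ky; rewrite /w add0r mulN1r normrN u1.
    - move=> y Ky; apply: diff_harmonicD; last exact: hu.
      move=> eps eps0; apply: filterS (nbhs_right_gt 0) => r _.
      rewrite /axis_diff2 big1; last by move=> j _; ring.
      by rewrite normr0 mulr_ge0 ?sqr_ge0 ?(ltW eps0).
  by rewrite /w; lra.
have [t0|t0] := leP 0 t; first by rewrite (ger0_norm t0) in td *; apply: le_abs; rewrite t0.
have := le_abs (- t); rewrite !scaleNr opprK distrC (ltr0_norm t0) in td *; apply.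
by rewrite td oppr_ge0 ltW.
Qed.

(** One moves from [x0] to [x] changing one coordinate at a time; each move is bounded by the cube
    estimate about its midpoint, with constants that do not depend on [u]. *)
Lemma harmonic_equicontinuous (Omega : set 'rV[R]_m) x0 eps :
    open Omega -> Omega x0 -> 0 < eps ->
  \forall x \near x0, forall u, harmonic_on Omega u ->
    (forall y, Omega y -> `|u y| <= 1) -> `|u x - u x0| <= eps.
Proof.
move=> oO Ox0 eps0.
have /nbhs_ballP[r /= r0 rO] : nbhs x0 Omega by exact: open_nbhs_nbhs.
(* The midpoints [p] are within [2 * d] of [x0], so the cubes of half-side [d] about them stay in
   the ball of radius [4 * d]. *)
pose d := r / 4; have d0 : 0 < d by rewrite divr_gt0.
(* There are [m] moves, each changing [u] by at most [m * c]. *)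
pose c := eps / (m.+1%:R * m.+1%:R).
have c0 : 0 < c by rewrite divr_gt0 ?mulr_gt0 ?ltr0n.
pose eta := Num.min d (c * d).
have eta0 : 0 < eta by rewrite lt_min d0 mulr_gt0.
apply/nbhs_ballP; exists eta => //= x [_ xx0] u hu u1.
have norm2V : `|(2 : R)^-1| = 2^-1 by rewrite gtr0_norm // invr_gt0.
have {}xx0 j : `|x 0 j - x0 0 j| < eta by rewrite distrC; exact: (xx0 0 j).
pose z (k : nat) : 'rV[R]_m := \row_j (if (j < k)%N then x 0 j else x0 0 j).
have step k : (k < m)%N -> `|u (z k.+1) - u (z k)| <= m%:R * c.
  move=> km; pose i := Ordinal km; pose tau := x 0 i - x0 0 i.
  pose p := z k + (tau / 2) *: e i.
  have zk : z k = p - (tau / 2) *: e i by rewrite /p addrK.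
  have zk1 : z k.+1 = p + (tau / 2) *: e i.
    apply/rowP => j; rewrite /p !coord_shift !mxE ltnS leq_eqVlt.
    have [->|ji] := eqVneq j i; first by rewrite eqxx ltnn /tau /=; field.
    by rewrite -val_eqE /= in ji; rewrite (negPf ji) /=; ring.
  have tau_eta : `|tau| < eta by exact: xx0.
  have eta_d : eta <= d by rewrite ge_min lexx.
  have pO y : cube p d y -> Omega y.
    move=> yp; apply: rO; split=> // a j; rewrite ord1 /ball /= distrC.
    have yx0 : `|y 0 j - x0 0 j| <= `|y 0 j - p 0 j| + `|p 0 j - x0 0 j| by exact: ler_distD.
    have px0 : `|p 0 j - x0 0 j| <= 2 * d.
      rewrite /p coord_shift mxE.
      have : `|(j == i)%:R * (tau / 2)| <= d.
        rewrite normrM normrM; have := normr_ge0 tau; have := lt_le_trans tau_eta eta_d.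
        rewrite norm2V.
        by case: (j == i) => /=; rewrite ?normr1 ?normr0; lra.
      have : `|(if (j < k)%N then x 0 j else x0 0 j) - x0 0 j| <= d.
        case: ifP => _; first by rewrite ltW // (lt_le_trans (xx0 j)).
        by rewrite subrr normr0 ltW.
      by rewrite !ler_norml => /andP[? ?] /andP[? ?]; apply/andP; split; lra.
    have rd : r = 4 * d by rewrite /d; field.
    by apply: le_lt_trans yx0 _; have := yp j; rewrite rd; lra.
  have hc y : cube p d y -> {for y, continuous u}.
    by move=> /pO; have [[du _] _] := hu; move=> /du/differentiable_continuous.
  rewrite zk zk1; apply: (@le_trans _ _ (2 * m%:R / d * `|tau / 2|)).
    apply: cube_estimate => //.
    - rewrite normrM norm2V.
      by have := normr_ge0 tau; have := lt_le_trans tau_eta eta_d; lra.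
    - by move=> y /pO; exact: u1.
    - move=> y yp; apply: (harmonic_diff_harmonic oO hu); apply: pO => j.
      by rewrite ltW.
  have -> : 2 * m%:R / d * `|tau / 2| = m%:R * (`|tau| / d).
    by rewrite normrM norm2V; field; rewrite gt_eqF.
  apply: ler_wpM2l => //; rewrite ler_pdivrMr //.
  by rewrite (le_trans (ltW tau_eta)) // ge_min lexx orbT.
have tele k : (k <= m)%N -> `|u (z k) - u (z 0%N)| <= k%:R * (m%:R * c).
  elim: k => [|k IHk] km; first by rewrite subrr normr0 mul0r.
  apply: le_trans (ler_distD (u (z k)) _ _) _.
  by rewrite -natr1 mulrDl mul1r addrC lerD ?IHk ?step // ltnW.
have := tele m (leqnn m).
have -> : z 0%N = x0 by apply/rowP => j; rewrite mxE.
have -> : z m = x by apply/rowP => j; rewrite mxE ltn_ord.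
move=> /le_trans; apply.
have -> : eps = m.+1%:R * (m.+1%:R * c) by rewrite /c; field; rewrite addrC natr1 pnatr_eq0.
have le_m : (m%:R : R) <= m.+1%:R by rewrite ler_nat.
have le_mc : m%:R * c <= m.+1%:R * c by apply: ler_wpM2r => //; exact: ltW.
by apply: ler_pM => //; apply: mulr_ge0 => //; exact: ltW.
Qed.
End Equicontinuity.

(** * Averages against the harmonic measure *)

Section L1Approximation.
Variables (R : realType) (V : normedModType R).
Local Notation B := (borel V).
Implicit Types (f g h : V -> R) (A : set V).

Lemma borel_open_measurable A : open A -> measurable (A : set B).
Proof. by move=> oA; exact: sub_sigma_algebra. Qed.

Lemma borel_closed_measurable A : closed A -> measurable (A : set B).
Proof.
by move=> /closed_openC/borel_open_measurable/measurableC; rewrite setCK.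
Qed.

Lemma continuous_borel_measurable (D : set B) f : measurable D -> continuous f ->
  measurable_fun D (f : B -> R).
Proof.
move=> mD cf; apply: (measurability _ (RGenOpens.measurableE R)).
move=> _ [_ [a [b ->] <-]]; apply: measurableI => //.
by apply: borel_open_measurable; move/continuousP : cf; apply; exact: interval_open.
Qed.

Definition L1dist (mu : probability B R) (D : set B) f g : \bar R :=
  (\int[mu]_(t in D) (`|f t - g t|)%:E)%E.

Lemma measurable_L1 (D : set B) f g : measurable D -> measurable_fun D (f : B -> R) ->
  measurable_fun D (g : B -> R) -> measurable_fun D (fun t : B => (`|f t - g t|)%:E).
Proof.
move=> mD mf mg; apply/measurable_EFinP.
by apply: measurableT_comp => //; exact: measurable_funB.
Qed.

Lemma L1dist_le (mu : probability B R) (D : set B) f g f1 g1 f2 g2 (c1 c2 : R) : measurable D ->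
    measurable_fun D (f : B -> R) -> measurable_fun D (g : B -> R) ->
    measurable_fun D (f1 : B -> R) -> measurable_fun D (g1 : B -> R) ->
    measurable_fun D (f2 : B -> R) -> measurable_fun D (g2 : B -> R) ->
    (forall t, D t -> `|f t - g t| <= `|f1 t - g1 t| + `|f2 t - g2 t|) ->
    (L1dist mu D f1 g1 <= c1%:E)%E -> (L1dist mu D f2 g2 <= c2%:E)%E ->
  (L1dist mu D f g <= (c1 + c2)%:E)%E.
Proof.
move=> mD mf mg mf1 mg1 mf2 mg2 le12 H1 H2; rewrite EFinD.
apply: le_trans (leeD H1 H2); rewrite /L1dist -ge0_integralD //; last 2 first.
- exact: measurable_L1.
- exact: measurable_L1.
apply: ge0_le_integral => //.
- exact: measurable_L1.
- by apply: emeasurable_funD; exact: measurable_L1.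
Qed.

(** The distance to the complement. If [A] is the whole space there is no distance to take, and the
    constant 1 serves. *)
Lemma open_cozero A : open A ->
  exists f, [/\ continuous f, forall x, 0 <= f x, forall x, A x -> 0 < f x
    & forall x, ~ A x -> f x = 0].
Proof.
move=> oA; have [[b nAb]|nnA] := pselect (exists b, ~ A b); last first.
  exists (cst 1); split=> // [|x nAx]; first exact: cst_continuous.
  by exfalso; apply: nnA; exists x.
pose S x := [set `|x - y| | y in ~` A].
pose f x := inf (S x).
have S0 x : has_inf (S x).
  by split; [exists `|x - b|, b | exists 0 => _ [y _ <-]].
have f_le x y : ~ A y -> f x <= `|x - y|.
  by move=> nAy; apply: ge_inf; [exact: (S0 x).2 | exists y].
have f_ge0 x : 0 <= f x by apply: lb_le_inf; [exact: (S0 x).1 | move=> _ [y _ <-]].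
have lip x y : f x <= `|x - y| + f y.
  rewrite -lerBlDl; apply: lb_le_inf; first exact: (S0 y).1.
  move=> _ [z nAz <-]; rewrite lerBlDl; apply: le_trans (f_le _ _ nAz) _.
  exact: ler_distD.
exists f; split=> //.
- move=> x; apply/cvgrPdist_le => eps eps0; near=> y.
  have : `|x - y| <= eps by near: y; exact: cvgr_dist_le.
  move=> xy; rewrite ler_norml; have := lip x y; have := lip y x.
  by rewrite distrC => ? ?; apply/andP; split; lra.
- move=> x Ax; have /nbhs_ballP[r /= r0 rA] : nbhs x A by exact: open_nbhs_nbhs.
  apply: (lt_le_trans r0); apply: lb_le_inf; first exact: (S0 x).1.
  move=> _ [y nAy <-]; rewrite leNgt; apply/negP => xy; apply: nAy; apply: rA.
  by rewrite -ball_normE.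
- by move=> x nAx; apply/eqP; rewrite eq_le f_ge0 andbT (le_trans (f_le _ _ nAx)) // subrr normr0.
Unshelve. all: by end_near. Qed.

Variables (k : nat) (mu : 'I_k -> probability B R) (D : set B).
Hypothesis mD : measurable D.

(** One function [f] serves all the measures at once, since averages must be approximated at several
    points of the domain by the same harmonic function. *)
Definition L1approximable g := forall eps : R, 0 < eps ->
  exists f, [/\ continuous f, forall t, 0 <= f t <= 1
    & forall i, (L1dist (mu i) D f g <= eps%:E)%E].

Let approx_set A := measurable (A : set B) /\ L1approximable \1_A.

Lemma measurable_indic_on A : measurable (A : set B) -> measurable_fun D (\1_A : B -> R).
Proof. by move=> mA; exact: measurable_indic. Qed.

Lemma approx_setC A : approx_set A -> approx_set (~` A).
Proof.
move=> [mA appA]; split=> [|eps eps0]; first exact: measurableC.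
have [f [cf f01 fA]] := appA _ eps0.
exists (fun t => 1 - f t); split.
- by move=> t; exact: (cvgB (cvg_cst _) (cf t)).
- by move=> t; have /andP[? ?] := f01 t; apply/andP; split; lra.
- move=> i; apply: le_trans (fA i); rewrite le_eqVlt; apply/orP; left; apply/eqP.
  apply: eq_integral => t _; rewrite !indicE in_setC distrC; congr (`|_|%:E).
  by case: (t \in A) => /=; ring.
Qed.

Lemma approx_setU A A' : approx_set A -> approx_set A' -> approx_set (A `|` A').
Proof.
move=> [mA appA] [mA' appA']; split=> [|eps eps0]; first exact: measurableU.
have e2 : 0 < eps / 2 by rewrite divr_gt0.
have [f [cf f01 fA]] := appA _ e2; have [g [cg g01 gA]] := appA' _ e2.
have ch : continuous (fun t => 1 - (1 - f t) * (1 - g t)).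
  move=> t; apply: (cvgB (cvg_cst _)).
  exact: (cvgM (cvgB (cvg_cst _) (cf t)) (cvgB (cvg_cst _) (cg t))).
exists (fun t => 1 - (1 - f t) * (1 - g t)); split=> //.
  by move=> t; have := f01 t; have := g01 t; nra.
move=> i; have -> : eps = eps / 2 + eps / 2 by field.
apply: (L1dist_le _ _ _ _ _ _ _ _ (fA i) (gA i)) => //;
  try exact: continuous_borel_measurable; try exact: measurable_indic_on.
  by apply: measurable_indic_on; exact: measurableU.
have n1 (z : R) : 0 <= z <= 1 -> `|z - 1| = 1 - z.
  by move=> /andP[_ z1]; rewrite ler0_norm ?opprB // subr_le0.
have n0 (z : R) : 0 <= z <= 1 -> `|z - 0| = z.
  by move=> /andP[z0 _]; rewrite subr0 ger0_norm.
move=> t _; have ft := f01 t; have gt := g01 t; rewrite !indicE in_setU.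
have ht : 0 <= 1 - (1 - f t) * (1 - g t) <= 1 by nra.
have /andP[f0 f1] := ft; have /andP[g0 g1] := gt.
by case: (t \in A); case: (t \in A') => /=; rewrite ?n1 ?n0 //; nra.
Qed.

(** Dominated convergence with bound 1, used for open sets and for countable unions. *)
Lemma L1dist_eventually_eq (f_ : nat -> V -> R) g (eps : R) : 0 < eps ->
    (forall n, measurable_fun D (f_ n : B -> R)) -> measurable_fun D (g : B -> R) ->
    (forall n t, `|f_ n t - g t| <= 1) ->
    (forall t, \forall n \near \oo, f_ n t = g t) ->
  \forall n \near \oo, forall i, (L1dist (mu i) D (f_ n) g <= eps%:E)%E.
Proof.
move=> eps0 mf mg le1 ev; apply: filter_forall => i.
have cvgf : (L1dist (mu i) D (f_ n) g @[n --> \oo] --> 0)%E.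
  have := @dominated_convergence _ B R (mu i) D mD
    (fun n t => (`|f_ n t - g t|)%:E) (cst 0%E) (cst 1%E).
  case.
  - by move=> n; exact: measurable_L1.
  - exact: measurable_cst.
  - apply: aeW => t Dt /=; apply: cvg_near_cst.
    by apply: filterS (ev t) => n ->; rewrite subrr normr0.
  - exact: (finite_measure_integrable_cst _ 1).
  - by apply: aeW => t n Dt /=; rewrite normr_id lee_fin.
  - by move=> _ _; rewrite integral0; exact.
have /fine_cvgP[fin cvg0] := cvgf.
have ler : \forall n \near \oo, fine (L1dist (mu i) D (f_ n) g) <= eps.
  exact: cvgr_le cvg0 _ eps0.
by apply: filterS2 fin ler => n fin_n; rewrite -lee_fin fineK.
Qed.

Lemma approx_open A : open A -> approx_set A.
Proof.
move=> oA; have mA := borel_open_measurable oA; split=> // eps eps0.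
have [d [cd d0 dA dnA]] := open_cozero oA.
(* At a point of [A] this equals 1 as soon as [n] is at least the inverse of [d t]; outside [A] it
   is 0. *)
pose f_ n t := Num.min 1 (n%:R * d t).
have cf n : continuous (f_ n).
  move=> t; apply: (@continuous_min R V (cst 1) (fun t => n%:R * d t)).
    exact: cvg_cst.
  exact: (cvgM (cvg_cst _) (cd t)).
have f01 n t : 0 <= f_ n t <= 1.
  by rewrite /f_ le_min ler01 mulr_ge0 // ge_min lexx.
have [||||n _ /(_ n (leqnn n)) fn] := @L1dist_eventually_eq f_ \1_A eps eps0.
- by move=> n; exact: continuous_borel_measurable.
- exact: measurable_indic_on.
- move=> n t; have /andP[f0 f1] := f01 n t; rewrite indicE ler_norml.
  by case: (t \in A) => /=; apply/andP; split; lra.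
- move=> t; have [At|nAt] := pselect (A t).
    have dt := dA _ At; apply: filterS (nbhs_infty_ger (d t)^-1) => n nd.
    rewrite indicE mem_set //= /f_ min_l // -(ler_pM2r (_ : 0 < (d t)^-1)) ?invr_gt0 //.
    by rewrite mul1r mulfK // gt_eqF.
  by near=> n; rewrite indicE memNset //= /f_ dnA // mulr0 min_r.
- by exists (f_ n); split.
Unshelve. all: by end_near. Qed.

Lemma approx_bigcup (F : (set V)^nat) : (forall n, approx_set (F n)) ->
  approx_set (\bigcup_n F n).
Proof.
move=> appF.
have mF : measurable (\bigcup_n F n : set B).
  by apply: bigcupT_measurable => n; exact: (appF n).1.
split=> // eps eps0; have e2 : 0 < eps / 2 by rewrite divr_gt0.
pose G n := \big[setU/set0]_(i < n) F i.
have appG n : approx_set (G n).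
  rewrite /G; elim: n => [|n IHn]; first by rewrite big_ord0; apply: approx_open; exact: open0.
  by rewrite big_ord_recr; apply: approx_setU.
have GE n t : G n t <-> exists2 j, (j < n)%N & F j t.
  by rewrite /G -(bigcup_mkord n F).
have [||||n _ /(_ n (leqnn n)) Gn] :=
    @L1dist_eventually_eq (fun n => \1_(G n)) \1_(\bigcup_n F n) _ e2.
- by move=> n; apply: measurable_indic_on; exact: (appG n).1.
- exact: measurable_indic_on.
- by move=> n t; rewrite !indicE; do 2!case: (_ \in _);
    rewrite ?subrr ?subr0 ?sub0r ?normrN ?normr0 ?normr1.
- move=> t; have [[j _ Fjt]|nFt] := pselect ((\bigcup_n F n) t).
    exists j.+1 => // n /= jn; rewrite !indicE !mem_set //; last by apply/GE; exists j.
    by exists j.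
  near=> n; rewrite !indicE !memNset // => /GE[j _ Fjt]; by apply: nFt; exists j.
have [f [cf f01 fG]] := (appG n).2 _ e2.
exists f; split=> // i; have -> : eps = eps / 2 + eps / 2 by field.
apply: (L1dist_le _ _ _ _ _ _ _ _ (fG i) (Gn i)) => //;
  try exact: continuous_borel_measurable; try exact: measurable_indic_on.
- by apply: measurable_indic_on; exact: (appG n).1.
- by apply: measurable_indic_on; exact: (appG n).1.
- by move=> t _; exact: ler_distD.
Unshelve. all: by end_near. Qed.

(** The approximable measurable sets contain the open sets and are stable under complements and
    countable unions, so they are all the Borel sets. *)
Lemma measurable_set_approximable A : measurable (A : set B) -> L1approximable \1_A.
Proof.
suff : (@measurable _ B) `<=` approx_set by move=> H mA; exact: (H _ mA).2.
apply: smallest_sub; last by move=> U oU; exact: approx_open.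
split.
- by apply: approx_open; exact: open0.
- by move=> U; rewrite setTD; exact: approx_setC.
- exact: approx_bigcup.
Qed.
End L1Approximation.

Section L1ApproximationOfFunctions.
Variables (R : realType) (V : normedModType R) (k : nat).
Local Notation B := (borel V).
Variables (mu : 'I_k -> probability B R) (D : set B).
Hypothesis mD : measurable D.

(** The sum counts the integers from 1 to [l] that are at most [x]; below [l.+1] it is the integer
    part of [x]. *)
Lemma sum_thresholds (l : nat) (x : R) : 0 <= x ->
  let S : R := \sum_(j < l) ((j.+1%:R : R) <= x)%R%:R in S <= x /\ (x < l.+1%:R -> x <= S + 1 :> R).
Proof.
move=> x0; elim: l => [|l [IH1 IH2]] /=.
  by rewrite big_ord0 add0r; split=> // /ltW.
rewrite big_ord_recr /=; have [lx|xl] := leP l.+1%:R x; last first.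
  by rewrite addr0; split=> // _; exact: IH2.
have -> : \sum_(j < l) ((j.+1%:R : R) <= x)%R%:R = l%:R :> R.
  rewrite (eq_bigr (fun=> 1)) => [|j _]; first by rewrite sumr_const card_ord.
  by rewrite (le_trans _ lx) // ler_nat ltnW // ltnS.
by rewrite natr1 natr1; split=> // /ltW.
Qed.

(** Layer cake: [g] is within [l%:R^-1] of the mean of the indicators of its [l] superlevel sets,
    and each of these indicators is approximable. *)
Lemma measurable_fun_approximable (g : V -> R) : measurable_fun D (g : B -> R) ->
  (forall t, D t -> 0 <= g t <= 1) -> L1approximable mu D g.
Proof.
move=> mg g01 eps eps0; have e2 : 0 < eps / 2 by rewrite divr_gt0.
pose l := (Num.bound (eps / 2)^-1).+1; have l0 : (0 : R) < l%:R by rewrite ltr0n.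
have le2 : l%:R^-1 <= eps / 2.
  rewrite -[leRHS]invrK lef_pV2 ?posrE ?invr_gt0 // ltW //.
  apply: (lt_trans (archi_boundP _)); rewrite ?ltr_nat //.
  by rewrite invr_ge0 ltW.
pose A (j : nat) : set B := D `&` (g : B -> R) @^-1` `[j.+1%:R / l%:R, +oo[.
have mA j : measurable (A j) by exact: mg.
pose g_ i t : R := \sum_(j < i) \1_(A j) t.
have mg_ i : measurable_fun D (g_ i : B -> R).
  by apply: measurable_sum => j; exact: measurable_indic_on.
have g_g t : D t -> `|l%:R^-1 * g_ l t - g t| <= l%:R^-1.
  move=> Dt; have /andP[g0 g1] := g01 _ Dt.
  have [|S1 S2] := @sum_thresholds l (l%:R * g t); first by rewrite mulr_ge0.
  have E : g_ l t = \sum_(j < l) ((j.+1%:R : R) <= l%:R * g t)%R%:R.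
    apply: eq_bigr => j _; rewrite indicE; congr (nat_of_bool _)%:R.
    apply/idP/idP => [/set_mem[_]|ge].
      by rewrite /= in_itv /= andbT ler_pdivrMr // mulrC.
    by apply/mem_set; split=> //; rewrite /= in_itv /= andbT ler_pdivrMr // mulrC.
  rewrite -E in S1 S2; have {}S2 := S2 _.
  have lg : l%:R * g t < l.+1%:R.
    by apply: (@le_lt_trans _ _ l%:R); rewrite ?ltr_nat // ler_piMr // ltW.
  have -> : l%:R^-1 * g_ l t - g t = l%:R^-1 * (g_ l t - l%:R * g t).
    by field; rewrite gt_eqF.
  rewrite normrM gtr0_norm ?invr_gt0 // ler_piMr ?invr_ge0 ?(ltW l0) //.
  by rewrite ler_norml; have := S2 lg; lra.
have l2 : 0 < eps / 2 / l%:R by rewrite divr_gt0.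
have [F HF] := choice (fun j : nat => measurable_set_approximable mu mD (mA j) l2).
pose f_ i t : R := \sum_(j < i) F j t.
have cf_ i : continuous (f_ i).
  apply: (continuous_big (@add_continuous _)) => j _; by have [] := HF j.
have f_dist i j : (L1dist (mu i) D (f_ j) (g_ j) <= (j%:R * (eps / 2 / l%:R))%:E)%E.
  elim: j => [|j IHj].
    rewrite mul0r /L1dist; under eq_integral do rewrite /f_ /g_ !big_ord0 subrr normr0.
    by rewrite integral0.
  have -> : j.+1%:R * (eps / 2 / l%:R) = j%:R * (eps / 2 / l%:R) + eps / 2 / l%:R.
    by rewrite -natr1 mulrDl mul1r.
  have [cF _ Fd] := HF j.
  apply: (L1dist_le _ _ _ _ _ _ _ _ IHj (Fd i)) => //;
    try exact: continuous_borel_measurable; try exact: measurable_indic_on.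
  move=> t _; rewrite /f_ /g_ !big_ord_recr /=.
  by apply: le_trans (ler_normD _ _); rewrite le_eqVlt; apply/orP; left; apply/eqP; congr `|_|; ring.
have cf : continuous (fun t => l%:R^-1 * f_ l t).
  by move=> t; exact: (cvgM (cvg_cst _) (cf_ l t)).
have mlg : measurable_fun D (fun t : B => l%:R^-1 * g_ l t).
  by apply: measurable_funM => //; exact: measurable_cst.
exists (fun t => l%:R^-1 * f_ l t); split=> //.
  move=> t; have F01 j : 0 <= F j t <= 1 by have [] := HF j.
  have S0 : 0 <= f_ l t by apply: sumr_ge0 => j _; have /andP[] := F01 j.
  have S1 : f_ l t <= l%:R.
    rewrite (_ : l%:R = \sum_(j < l) (1 : R)); last by rewrite sumr_const card_ord.
    by apply: ler_sum => j _; have /andP[] := F01 j.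
  by rewrite mulr_ge0 ?invr_ge0 ?(ltW l0) //= mulrC ler_pdivrMr // mul1r.
move=> i; have -> : eps = eps / 2 + eps / 2 by field.
pose ff t : R := l%:R^-1 * f_ l t; pose gg t : R := l%:R^-1 * g_ l t.
have H1 : (L1dist (mu i) D ff gg <= (eps / 2)%:E)%E.
  have -> : eps / 2 = l%:R * (eps / 2 / l%:R) + 0 by field; rewrite gt_eqF.
  have H0 : (L1dist (mu i) D (cst 0%R) (cst 0%R) <= (0 : R)%:E)%E.
    by rewrite /L1dist; under eq_integral do rewrite subrr normr0; rewrite integral0.
  apply: (L1dist_le _ _ _ _ _ _ _ _ (f_dist i l) H0) => //;
    try exact: continuous_borel_measurable; try exact: measurable_cst.
  move=> t _; rewrite /= subrr normr0 addr0 -mulrBr normrM ler_piMl // gtr0_norm ?invr_gt0 //.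
  by rewrite invf_le1 // (ler_nat _ 1).
have H2 : (L1dist (mu i) D gg g <= (eps / 2)%:E)%E.
  apply: (@le_trans _ _ (\int[mu i]_(t in D) (cst (l%:R^-1)%:E) t)%E).
    by apply: ge0_le_integral => //; exact: measurable_L1.
  rewrite integral_cst //; apply: (@le_trans _ _ (l%:R^-1)%:E); last by rewrite lee_fin.
  by rewrite -[leRHS]mule1 lee_pmul2l ?lte_fin ?invr_gt0 // probability_le1.
apply: (L1dist_le _ _ _ _ _ _ _ _ H1 H2) => //; try exact: continuous_borel_measurable.
by move=> t _; exact: ler_distD.
Qed.
End L1ApproximationOfFunctions.

Section HarmonicAverages.
Variables (R : realType) (m : nat) (Omega : set 'rV[R]_m).
Variable mu : 'rV[R]_m -> probability (borel 'rV[R]_m) R.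
Hypotheses (oO : open Omega) (mu_harm : is_harmonic_measure Omega mu).
Local Notation B := (borel 'rV[R]_m).
Local Notation D := (boundary Omega : set B).
Implicit Types (f g : 'rV[R]_m -> R) (x y z c : 'rV[R]_m) (eps r : R).

Lemma measurable_boundary : measurable D.
Proof.
apply: borel_closed_measurable; apply: closedI; first exact: closed_closure.
by apply: open_closedC; exact: open_interior.
Qed.

(** In dimension 0 a nonempty set is the whole space; its boundary is empty and cannot have mass
    1. *)
Lemma dimension_gt0 x : Omega x -> (0 < m)%N.
Proof.
move=> Ox; rewrite lt0n; apply/negP => /eqP m0.
have D0 : D = set0.
  apply/seteqP; split=> // y [_]; apply.
  have -> : y = x by apply/rowP => j; exfalso; have := ltn_ord j; rewrite [X in (_ < X)%N]m0.
  exact: open_nbhs_nbhs (conj oO Ox).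
have := mu_harm.1 x Ox; rewrite D0 measure0 => /eqP.
by rewrite eqe eq_sym oner_eq0.
Qed.

Definition unit_valued g := measurable_fun D (g : B -> R) /\ forall t, D t -> 0 <= g t <= 1.

Definition average g x : R := \int[mu x]_(t in D) g t.

Lemma unit_valued_integrable g x : unit_valued g -> (mu x).-integrable D (EFin \o g).
Proof.
move=> [mg g01]; apply: (@le_integrable _ _ _ (mu x) D measurable_boundary _ (EFin \o cst 1)).
- exact/measurable_EFinP.
- by move=> t Dt; have /andP[g0 g1] := g01 _ Dt; rewrite /= lee_fin normr1 ger0_norm.
- exact: finite_measure_integrable_cst measurable_boundary.
Qed.

Lemma average_dist f g x eps : unit_valued f -> unit_valued g ->
  (L1dist (mu x) D f g <= eps%:E)%E -> `|average f x - average g x| <= eps.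
Proof.
move=> uf ug fg; have mD := measurable_boundary.
rewrite /average -RintegralB //; try exact: unit_valued_integrable.
have int : (mu x).-integrable D (EFin \o (fun t => f t - g t)).
  exact: (integrableB mD (unit_valued_integrable x uf) (unit_valued_integrable x ug)).
apply: le_trans (le_normr_Rintegral _ _) _ => //.
rewrite -lee_fin; apply: le_trans fg; rewrite /Rintegral fineK //.
by apply: (integrable_fin_num mD); exact: integrable_norm.
Qed.

Lemma average01 g x : Omega x -> unit_valued g -> 0 <= average g x <= 1.
Proof.
move=> Ox [mg g01]; have mD := measurable_boundary.
rewrite Rintegral_ge0 /=; last by move=> t Dt; have /andP[] := g01 _ Dt.
rewrite -lee_fin /average /Rintegral fineK; last first.
  by apply: (integrable_fin_num mD); apply: unit_valued_integrable.
have <- : (\int[mu x]_(t in D) (cst 1%:E) t = 1)%E by rewrite integral_cst // mul1e; exact: mu_harm.1.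
apply: ge0_le_integral => //.
- by move=> t Dt; have /andP[] := g01 _ Dt; rewrite lee_fin.
- exact/measurable_EFinP.
- by move=> t Dt; have /andP[] := g01 _ Dt; rewrite lee_fin.
Qed.

Lemma unit_valued_continuous f : continuous f -> (forall t, 0 <= f t <= 1) -> unit_valued f.
Proof. by move=> cf f01; split=> //; exact: continuous_borel_measurable measurable_boundary cf. Qed.

Lemma average_harmonic f : continuous f -> harmonic_on Omega (average f).
Proof. by move=> cf; have [] := mu_harm.2 f (continuous_subspaceT cf). Qed.

(** For given [x] and [g], a continuous [f] is close to [g] in L1 for the measures at both [x] and
    [z]. Its average is harmonic with values in [[0, 1]], and the neighbourhood of equicontinuity
    was fixed before [f]. *)
Lemma average_equicontinuous z eps : Omega z -> 0 < eps ->
  \forall x \near z, Omega x /\ forall g, unit_valued g -> `|average g x - average g z| <= eps.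
Proof.
move=> Oz eps0; have e3 : 0 < eps / 3 by rewrite divr_gt0.
have Onear : \forall x \near z, Omega x by exact: open_nbhs_nbhs.
apply: filterS2 Onear (harmonic_equicontinuous oO Oz e3) => x Ox H; split=> // g ug.
have [f [cf f01 fg]] := measurable_fun_approximable
  (fun i : 'I_2 => mu (if i == ord0 then x else z)) measurable_boundary ug.1 ug.2 e3.
have uf := unit_valued_continuous cf f01.
have dx := average_dist uf ug (fg ord0); have dz := average_dist uf ug (fg ord_max).
have {}H := H _ (average_harmonic cf).
have := H _; rewrite /= in dx dz.
have -> : average g x - average g z = (average f x - average f z)
  - (average f x - average g x) + (average f z - average g z) by ring.
move=> H'; apply: (le_trans (ler_normD _ _)); apply: (le_trans (lerD (ler_normB _ _) (lexx _))).
have : `|average f x - average f z| <= eps / 3.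
  by apply: H' => y Oy; have /andP[a0 a1] := average01 Oy uf; rewrite ger0_norm.
lra.
Qed.

Lemma enormE x : enorm x = Num.sqrt (sqnorm x).
Proof. by rewrite /enorm big_ord1. Qed.

Lemma enorm_ltE x r : 0 < r -> (enorm x < r) = (sqnorm x < r ^+ 2).
Proof. by move=> r0; rewrite enormE -(ltr_sqrt _ (exprn_gt0 2 r0)) sqrtr_sqr (gtr0_norm r0). Qed.

Lemma enorm_leE x r : 0 < r -> (enorm x <= r) = (sqnorm x <= r ^+ 2).
Proof. by move=> r0; rewrite enormE -(ler_sqrt _ (sqr_ge0 r)) sqrtr_sqr (gtr0_norm r0). Qed.

Lemma shifted_sqnorm_continuous c : continuous (fun x => sqnorm (x - c)).
Proof.
move=> x; apply: (@continuous_comp _ _ _ (fun x => x - c) (@sqnorm R m)).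
  exact: (cvgB cvg_id (cvg_cst _)).
exact: sqnorm_continuous.
Qed.

Lemma eball_open c r : 0 < r -> open (eball c r).
Proof.
move=> r0; rewrite (_ : eball c r = (fun x => sqnorm (x - c)) @^-1` [set s | s < r ^+ 2]).
  apply: open_comp; last exact: open_lt.
  by move=> x _; exact: shifted_sqnorm_continuous.
by apply/seteqP; split=> x; rewrite /eball /= enorm_ltE.
Qed.

Lemma closed_eball_compact c r : 0 < r -> compact (closed_eball c r).
Proof.
move=> r0; apply: (@subclosed_compact _ _ (cube c r)); last 1 first.
- move=> x; rewrite /closed_eball /= enorm_leE // => xc j.
  have : (x 0 j - c 0 j) ^+ 2 <= r ^+ 2.
    apply: le_trans xc; rewrite /sqnorm (bigD1 j) //= !mxE lerDl.
    by apply: sumr_ge0 => i _; rewrite sqr_ge0.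
  by rewrite -ler_sqrt ?exprn_ge0 ?sqr_ge0 ?(ltW r0) // !sqrtr_sqr (gtr0_norm r0).
- rewrite (_ : closed_eball c r = (fun x => sqnorm (x - c)) @^-1` [set s | s <= r ^+ 2]).
    by apply: preimage_closed; [move=> x _; exact: shifted_sqnorm_continuous | exact: closed_le].
  by apply/seteqP; split=> x; rewrite /closed_eball /= enorm_leE.
- exact: cube_compact.
Qed.

Lemma esphere_compact c r : 0 < r -> compact (esphere c r).
Proof.
move=> r0; apply: (@subclosed_compact _ _ (closed_eball c r)); last 1 first.
- by move=> x; rewrite /esphere /closed_eball /= => ->.
- rewrite (_ : esphere c r = (fun x => sqnorm (x - c)) @^-1` [set s | s = r ^+ 2]).
    by apply: preimage_closed; [move=> x _; exact: shifted_sqnorm_continuous | exact: closed_eq].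
  apply/seteqP; split=> x; rewrite /esphere /= enormE => H.
    by rewrite -H sqr_sqrtr // sqnorm_ge0.
  by rewrite H sqrtr_sqr gtr0_norm.
- exact: closed_eball_compact.
Qed.
End HarmonicAverages.

(** * Comparison of averages with harmonic functions on balls *)

Section ComparisonWithAverages.
Variables (R : realType) (m : nat) (Omega : set 'rV[R]_m).
Variable mu : 'rV[R]_m -> probability (borel 'rV[R]_m) R.
Hypotheses (oO : open Omega) (mu_harm : is_harmonic_measure Omega mu).
Local Notation B := (borel 'rV[R]_m).
Local Notation D := (boundary Omega : set B).
Implicit Types (f g h : 'rV[R]_m -> R) (x y z c : 'rV[R]_m) (eps r : R).

Lemma average_simultaneous_approximation g (zs : seq 'rV[R]_m) eps :
    unit_valued Omega g -> 0 < eps ->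
  exists f, [/\ continuous f, unit_valued Omega f
    & forall z, z \in zs -> `|average Omega mu f z - average Omega mu g z| <= eps].
Proof.
move=> ug eps0.
have [f [cf f01 fg]] := measurable_fun_approximable
  (fun i : 'I_(size zs) => mu (nth 0 zs i)) (measurable_boundary Omega) ug.1 ug.2 eps0.
have uf := unit_valued_continuous Omega cf f01.
exists f; split=> // z zzs; apply: average_dist => //.
have iz : (index z zs < size zs)%N by rewrite index_mem.
by have := fg (Ordinal iz); rewrite /= nth_index.
Qed.

(** A continuous [f] is chosen whose average is close to that of [g] at [y] and at finitely many
    points of the sphere. Equicontinuity extends this closeness to the whole sphere, and the maximum
    principle applies to the harmonic average of [f]. *)
Lemma average_comparison g c r h (C kappa : R) : unit_valued Omega g -> 0 <= C -> 0 < r ->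
    closed_eball c r `<=` Omega -> {within closed_eball c r, continuous h} ->
    harmonic_on (eball c r) h ->
    (forall y, esphere c r y -> h y <= C * average Omega mu g y + kappa) ->
  forall y, eball c r y -> h y <= C * average Omega mu g y + kappa.
Proof.
move=> ug C0 r0 KO ch hh hS y By.
have eballK x : eball c r x -> closed_eball c r x by move=> /ltW.
have m0 : (0 < m)%N by apply: (dimension_gt0 oO mu_harm (x := y)); apply/KO/eballK.
suff main eps : 0 < eps -> h y <= C * (average Omega mu g y + 4 * eps) + kappa.
  apply/ler_addgt0Pr => e e0.
  have C1 : 0 < 4 * (C + 1) by rewrite mulr_gt0 // ltr_wpDl.
  have := main (e / (4 * (C + 1))) (divr_gt0 e0 C1).
  have : C * (4 * (e / (4 * (C + 1)))) <= e.
    have -> : C * (4 * (e / (4 * (C + 1)))) = e * (C / (C + 1)).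
      by field; rewrite gt_eqF // ltr_wpDl.
    by rewrite ler_piMr ?(ltW e0) // ler_pdivrMr ?ltr_wpDl // mul1r lerDl.
  lra.
move=> eps0.
pose W z := [set x | Omega x /\
  forall f, unit_valued Omega f -> `|average Omega mu f x - average Omega mu f z| <= eps].
have SK x : esphere c r x -> closed_eball c r x by rewrite /esphere /closed_eball /= => ->.
have := esphere_compact (c := c) r0; rewrite compact_cover => /(_ _ (esphere c r) (fun z => (W z)°)).
case.
- by move=> z _; exact: open_interior.
- move=> z Sz; exists z => //=; have Oz : Omega z by exact/KO/SK.
  exact: (average_equicontinuous oO mu_harm Oz eps0).
move=> F FS Fcov.
have [f [cf uf fz]] := average_simultaneous_approximation (y :: finmap.enum_fset F) ug eps0.
(* Three errors: from [x] to [z] for [g], from [g] to [f] at [z], and back from [z] to [x] for [f].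
   The fourth [eps] is the error at [y]. *)
have fS x : esphere c r x -> average Omega mu g x <= average Omega mu f x + 3 * eps.
  move=> Sx; have [z zF Wz] := Fcov _ Sx.
  have [Ox Hx] := interior_subset Wz.
  have h1 := Hx _ ug; have h2 := Hx _ uf.
  have h3 : `|average Omega mu f z - average Omega mu g z| <= eps by apply: fz; rewrite inE zF orbT.
  by move: h1 h2 h3; rewrite !ler_norml => /andP[? ?] /andP[? ?] /andP[? ?]; lra.
have fy : average Omega mu f y <= average Omega mu g y + eps.
  by have := fz y (mem_head _ _); rewrite ler_norml => /andP[? ?]; lra.
pose w x := (h x + (- C) * average Omega mu f x) + (-1) * (C * (3 * eps) + kappa).
have hf := average_harmonic mu_harm cf.
have : w y <= 0.
  apply: (maximum_principle m0 (closed_eball_compact (c := c) r0)); last exact: eballK.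
    apply: (within_continuousD (w := cst (C * (3 * eps) + kappa))); last first.
      exact/continuous_subspaceT/cst_continuous.
    apply: within_continuousD => //; apply: continuous_in_subspaceT => x /set_mem /KO Ox.
    by apply: differentiable_continuous; exact: hf.1.1.
  move=> x Kx; have [Bx|nBx] := boolP (enorm (x - c) < r); last first.
    left; have Sx : esphere c r x.
      by apply/eqP; rewrite eq_le Kx leNgt nBx.
    have : C * average Omega mu g x <= C * (average Omega mu f x + 3 * eps).
      by rewrite ler_wpM2l // fS.
    by have := hS _ Sx; rewrite /w; lra.
  right; split.
    apply: (@diff_harmonicD _ _ _ (cst (C * (3 * eps) + kappa))).
      apply: diff_harmonicD; first exact: harmonic_diff_harmonic (eball_open (c := c) r0) hh Bx.
      by apply: (harmonic_diff_harmonic oO hf); exact: KO.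
    move=> e e0; apply: filterS (nbhs_right_gt 0) => s _.
    rewrite /axis_diff2 big1; last by move=> j _ /=; ring.
    by rewrite normr0 mulr_ge0 ?sqr_ge0 ?(ltW e0).
  apply: filter_forall => j.
  have near_shift (sg : R) : \forall s \near 0^'+, closed_eball c r (x + s *: (sg *: basis_vec R j)).
    have cl : (fun s : R => x + s *: (sg *: basis_vec R j)) @ (0 : R) --> x + 0 *: (sg *: basis_vec R j).
      by apply: cvgD; [exact: cvg_cst | apply: cvgZr_tmp; exact: cvg_id].
    apply: cvg_within; apply: cl; rewrite scale0r addr0.
    by apply: filterS (open_nbhs_nbhs (conj (eball_open (c := c) r0) Bx)) => z /eballK.
  apply: filterS2 (near_shift 1) (near_shift (-1)) => s.
  by rewrite scale1r scaleN1r scalerN.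
rewrite /w => wy.
have : C * average Omega mu f y <= C * (average Omega mu g y + eps) by rewrite ler_wpM2l.
lra.
Qed.
End ComparisonWithAverages.

(** * Superharmonicity *)

Section SuperharmonicLimits.
Variables (R : realType) (m : nat).
Implicit Types (U : set 'rV[R]_m) (h : 'rV[R]_m -> R) (F : 'rV[R]_m -> \bar R).

Lemma partial_shift (i : 'I_m) h (e : R) : partial i (fun y => h y - e) = partial i h.
Proof.
apply/funext => x; rewrite /partial /derive.
have -> // : (fun s : R => s^-1 *: (((fun y => h y - e) \o shift x) (s *: basis_vec R i) - (h x - e))) =
  (fun s => s^-1 *: ((h \o shift x) (s *: basis_vec R i) - h x)).
by apply/funext => s /=; rewrite opprB addrA subrK.
Qed.

Lemma harmonic_on_shift U h (e : R) : harmonic_on U h -> harmonic_on U (fun y => h y - e).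
Proof.
move=> [[dh dph] lap]; split.
  split=> [x Ux|i]; last by rewrite partial_shift; exact: dph.
  exact: (differentiableB (dh _ Ux) (@differentiable_cst R _ _ e x)).
by move=> x Ux; rewrite /laplacian; under eq_bigr do rewrite partial_shift; exact: lap.
Qed.

Lemma within_continuous_shift (K : set 'rV[R]_m) h (e : R) :
  {within K, continuous h} -> {within K, continuous (fun y => h y - e)}.
Proof. by move=> ch y; exact: (cvgB (ch y) (cvg_cst _)). Qed.

(** As in Dini's theorem: the sphere is compact, [h] continuous and the [F_ k] lower semicontinuous
    and increasing, so one [F_ k] lies above [h - e] on the whole sphere. *)
Lemma superharmonic_on_sup U (F_ : nat -> 'rV[R]_m -> \bar R) F :
    (forall k, superharmonic_on U (F_ k)) ->
    (forall k l x, U x -> (k <= l)%N -> (F_ k x <= F_ l x)%E) ->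
    (forall k x, U x -> (F_ k x <= F x)%E) ->
    (forall x (a : R), U x -> (a%:E < F x)%E -> exists k, (a%:E < F_ k x)%E) ->
  superharmonic_on U F.
Proof.
move=> sF ndF leF supF; split.
- move=> x Ux; have [+ _ _] := sF 0%N => /(_ _ Ux) H.
  exact: lt_le_trans H (leF 0%N x Ux).
- move=> x a Ux /(supF _ _ Ux)[k ak].
  have [_ lsc _] := sF k; have := lsc _ _ Ux ak; rewrite !near_withinE.
  by apply: filterS => y H Uy; exact: lt_le_trans (H Uy) (leF k y Uy).
move=> c r h r0 KU ch hh hS y By.
have Uy : U y by apply: KU; rewrite /closed_eball /= ltW.
apply/lee_addgt0Pr => e e0.
have SK x : esphere c r x -> closed_eball c r x by rewrite /esphere /closed_eball /= => ->.
have e2 : 0 < e / 2 by rewrite divr_gt0.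
have /near_covering_withinP ncS : near_covering (esphere c r).
  by apply/compact_near_coveringP; exact: esphere_compact.
have : \forall k \near \oo, esphere c r `<=` (fun x => ((h x - e)%:E <= F_ k x)%E).
  apply: ncS => x Sx; have Kx := SK _ Sx; have Ux := KU _ Kx.
  have hx : ((h x - e / 2)%:E < F x)%E.
    by apply: lt_le_trans (hS _ Sx); rewrite lte_fin ltrBlDr ltrDl.
  have [k kx] := supF _ _ Ux hx.
  have [_ lsc _] := sF k; have lx := lsc _ _ Ux kx.
  have hnear : \forall x' \near x, closed_eball c r x' -> h x' <= h x + e / 2.
    have /subspace_continuousP chx := ch.
    have := chx x Kx => /cvgrPdist_le /(_ _ e2); rewrite near_withinE.
    apply: filterS => x' H Kx'; have := H Kx'; rewrite /from_subspace ler_norml => /andP[]; lra.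
  exists ((fun x' => U x' -> ((h x - e / 2)%:E < F_ k x')%E) `&`
     (fun x' => closed_eball c r x' -> h x' <= h x + e / 2), [set l | (k <= l)%N]) => /=.
    by split; [exact: filterI | exists k].
  move=> [x' l] /= [[H1 H2] kl] Sx'; have Ux' := KU _ (SK _ Sx').
  apply: (le_trans _ (ndF _ _ _ Ux' kl)); apply: le_trans (ltW (H1 Ux')).
  by rewrite lee_fin; have := H2 (SK _ Sx'); lra.
move=> [k _ /(_ k (leqnn k)) Hk].
have [_ _ comp] := sF k.
have := comp c r _ r0 KU (within_continuous_shift (e := e) ch) (harmonic_on_shift e hh) Hk y By.
rewrite EFinB leeBlDr // => /le_trans; apply.
by rewrite leeD2r // leF.
Qed.

(** For the comparison, [h] is lowered by [e / 2] to pass to [G] on the sphere, and another [e / 2]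
    is lost in returning to [F]. *)
Lemma superharmonic_on_uniform_limit U (F : 'rV[R]_m -> R) :
    (forall e : R, 0 < e -> exists2 G : 'rV[R]_m -> R,
      superharmonic_on U (EFin \o G) & forall x, U x -> `|F x - G x| <= e) ->
  superharmonic_on U (EFin \o F).
Proof.
move=> appF; split=> [x Ux|x a Ux|c r h r0 KU ch hh hS y By]; first exact: ltNyr.
- rewrite lte_fin => aF; have e0 : 0 < (F x - a) / 3 by rewrite divr_gt0 // subr_gt0.
  have [G [_ lscG _] FG] := appF _ e0.
  have aG : ((a + (F x - a) / 3)%:E < (EFin \o G) x)%E.
    by rewrite lte_fin; have := FG _ Ux; rewrite ler_norml => /andP[]; lra.
  have := lscG _ _ Ux aG; rewrite !near_withinE; apply: filterS => z H Uz.
  by have := H Uz; rewrite !lte_fin; have := FG _ Uz; rewrite ler_norml => /andP[]; lra.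
- have Uy : U y by apply: KU; rewrite /closed_eball /= ltW.
  apply/lee_addgt0Pr => e e0; have e2 : 0 < e / 2 by rewrite divr_gt0.
  have [G [_ _ compG] FG] := appF _ e2.
  have := compG c r _ r0 KU (within_continuous_shift (e := e / 2) ch)
    (harmonic_on_shift (e / 2) hh) _ y By.
  have H z : esphere c r z -> ((h z - e / 2)%:E <= (EFin \o G) z)%E.
    move=> Sz; have Uz : U z by apply: KU; rewrite /closed_eball /= Sz.
    have := hS _ Sz; rewrite !lee_fin; have := FG _ Uz; rewrite ler_norml => /andP[]; lra.
  move=> /(_ H); rewrite !lee_fin; have := FG _ Uy; rewrite ler_norml => /andP[]; lra.
Qed.
End SuperharmonicLimits.

Lemma Rintegral_bigsum d (T : measurableType d) (R : realType) (mu : {measure set T -> \bar R})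
    (D : set T) (I : Type) (s : seq I) (f : I -> T -> R) : measurable D ->
    (forall i, mu.-integrable D (EFin \o f i)) ->
  mu.-integrable D (EFin \o (fun t => \sum_(i <- s) f i t)) /\
  \int[mu]_(t in D) (\sum_(i <- s) f i t) = \sum_(i <- s) \int[mu]_(t in D) f i t.
Proof.
move=> mD fi; elim: s => [|b s [IHi IHa]].
  split; last first.
    by rewrite big_nil; under eq_Rintegral do rewrite big_nil; rewrite Rintegral_cst // mul0r.
  rewrite (_ : EFin \o _ = cst 0%E); first exact: integrable0.
  by apply/funext => t; rewrite /= big_nil.
have E : (fun t => \sum_(i <- b :: s) f i t) = (fun t => f b t + \sum_(i <- s) f i t).
  by apply/funext => t; rewrite big_cons.
rewrite E big_cons; split; first exact: (integrableD mD (fi b) IHi).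
by rewrite RintegralD // -IHa.
Qed.

(** * Superharmonicity for finitely supported laws *)

Section MixedOfAverages.
Variables (R : realType) (m n N : nat) (Omega : set 'rV[R]_m).
Variable mu : 'rV[R]_m -> probability (borel 'rV[R]_m) R.
Hypotheses (oO : open Omega) (mu_harm : is_harmonic_measure Omega mu).
Local Notation B := (borel 'rV[R]_m).
Local Notation D := (boundary Omega : set B).
Variables (v : 'I_N -> 'rV[R]_n) (g : 'I_N -> 'rV[R]_m -> R).
Hypothesis ug : forall b, unit_valued Omega (g b).

(** The combination is [C] times the average of one function with values in [[0, 1]]; the summand 1
    in [C] keeps it positive when all coefficients are zero. *)
Lemma average_comparison_sum (cf : 'I_N -> R) (kappa : R) c r h : (forall b, 0 <= cf b) -> 0 < r ->
    closed_eball c r `<=` Omega -> {within closed_eball c r, continuous h} ->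
    harmonic_on (eball c r) h ->
    (forall y, esphere c r y -> h y <= \sum_b cf b * average Omega mu (g b) y + kappa) ->
  forall y, eball c r y -> h y <= \sum_b cf b * average Omega mu (g b) y + kappa.
Proof.
move=> cf0 r0 KO ch hh hS; have mD := measurable_boundary Omega.
pose C := \sum_b cf b + 1; have S0 : 0 <= \sum_b cf b by apply: sumr_ge0.
have C0 : 0 < C by rewrite ltr_wpDl.
pose G t := \sum_b (cf b / C) * g b t.
have uG : unit_valued Omega G.
  split=> [|t Dt].
    by apply: measurable_sum => b; apply: measurable_funM; [exact: measurable_cst | exact: (ug b).1].
  have gt b := (ug b).2 _ Dt; apply/andP; split.
    by apply: sumr_ge0 => b _; have /andP[g0 _] := gt b; rewrite mulr_ge0 ?divr_ge0 // ltW.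
  apply: (@le_trans _ _ (\sum_b cf b / C)).
    apply: ler_sum => b _; have /andP[_ g1] := gt b.
    by rewrite ler_piMr // divr_ge0 // ltW.
  by rewrite -mulr_suml ler_pdivrMr // mul1r lerDl.
have avG x : C * average Omega mu G x = \sum_b cf b * average Omega mu (g b) x.
  have ig b : (mu x).-integrable D (EFin \o g b) by exact: unit_valued_integrable.
  have icg b : (mu x).-integrable D (EFin \o (fun t => cf b / C * g b t)).
    exact: (integrableZl mD (cf b / C) (ig b)).
  have [_ avS] := Rintegral_bigsum (index_enum 'I_N) mD icg.
  rewrite /average avS mulr_sumr; apply: eq_bigr => b _; rewrite RintegralZl //.
  by field; exact: lt0r_neq0.
move=> y By; rewrite -avG; apply: (average_comparison oO mu_harm uG (ltW C0) r0 KO ch hh) By.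
by move=> z /hS; rewrite -avG.
Qed.

Lemma cvg_mixed T (F : set_system T) (FF : Filter F) (w : T -> 'I_N -> R) (l : 'I_N -> R) :
  (forall b, w z b @[z --> F] --> l b) ->
  mixed v (fun=> w z) @[z --> F] --> mixed v (fun=> l).
Proof.
move=> cw; apply: (cvg_big (@add_continuous _)) => a _.
apply: cvgMr_tmp; apply: (cvg_big (@mul_continuous R)) => i _; exact: cw.
Qed.

(** For the comparison at [y], the root of the volume polynomial is replaced by its supporting
    linear form at the weights of [y]. These are shifted by [eps] to make them positive. *)
Lemma superharmonic_mixed_average (n_gt0 : (0 < n)%N) :
  superharmonic_on Omega
    (EFin \o (fun x => mixed v (fun=> (fun b => average Omega mu (g b) x)) `^ n%:R^-1)).
Proof.
pose w x b := average Omega mu (g b) x; pose p x := mixed v (fun=> w x).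
have w0 x b : Omega x -> 0 <= w x b.
  by move=> Ox; have /andP[] := average01 mu_harm Ox (ug b).
have p0 x : Omega x -> 0 <= p x by move=> Ox; apply: mixed_ge0 => *; exact: w0.
have wc x : Omega x -> forall b, w z b @[z --> x] --> w x b.
  move=> Ox b; apply/(@cvgrPdist_le _ _ _ _ (nbhs_filter x)) => eps eps0.
  apply: (@filterS _ _ (nbhs_filter x)) (average_equicontinuous oO mu_harm Ox eps0) => y [_ Hy].
  by rewrite distrC; exact: Hy.
pose F x := p x `^ n%:R^-1; rewrite -[superharmonic_on _ _]/(superharmonic_on Omega (EFin \o F)).
have F0 x : 0 <= F x by exact: powR_ge0.
have FE x : F x = p x `^ n%:R^-1 by [].
move: F F0 FE => F F0 FE.
split=> [x Ox|x a Ox|c r h r0 KO ch hh hS y By]; first exact: ltNyr.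
- rewrite lte_fin => ap; rewrite near_withinE.
  (* Negative levels are trivial; for the others the [n]-th powers are compared, using continuity of
     the polynomial. *)
  have [a0|a0] := ltP a 0.
    by near=> y => Oy; rewrite lte_fin (lt_le_trans a0).
  have apn : a ^+ n < p x.
    by rewrite -[ltRHS](@exprn_powR_inv R n) ?p0 // -FE ltr_pXn2r ?nnegrE.
  have := cvg_mixed (nbhs_filter x) (wc _ Ox) => /cvgr_gt /(_ _ apn).
  apply: filterS => y apy Oy; rewrite lte_fin -[ltLHS](@powR_inv_exprn R n) // FE.
  by apply: gt0_ltr_powR; rewrite ?invr_gt0 ?ltr0n ?nnegrE ?exprn_ge0 ?p0.
have KO' z : esphere c r z -> Omega z by move=> Sz; apply: KO; rewrite /closed_eball /= Sz.
have Oy : Omega y by apply: KO; rewrite /closed_eball /= ltW.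
have main eps : 0 < eps -> h y <= mixed v (fun=> fun b => w y b + eps) `^ n%:R^-1.
  move=> eps0.
  have [|cf [cf0 supp eqy]] := @mixed_support R n N v n_gt0 (fun b => w y b + eps).
    by move=> b; rewrite ltr_wpDl // w0.
  (* The part of the linear form that comes from the shift [eps] is the constant [kappa] of the
     comparison. *)
  rewrite eqy; under eq_bigr do rewrite mulrDr; rewrite big_split /=.
  apply: (average_comparison_sum cf0 r0 KO ch hh _ By) => z Sz.
  have := hS _ Sz; rewrite lee_fin => /le_trans; apply; rewrite FE.
  have Oz := KO' _ Sz.
  apply: (@le_trans _ _ (mixed v (fun=> fun b => w z b + eps) `^ n%:R^-1)).
    have wz b : 0 <= w z b + eps by rewrite addr_ge0 ?w0 // ltW.
    apply: (@ge0_ler_powR _ n%:R^-1); rewrite ?invr_ge0 ?nnegrE ?p0 //.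
      by apply: mixed_ge0.
    apply: ler_sum => a _; apply: ler_wpM2r => //; apply: ler_prod => i _.
    by rewrite w0 //= lerDl ltW.
  apply: le_trans (supp _ _) _; first by move=> b; rewrite ltr_wpDl // w0.
  by under [leLHS]eq_bigr do rewrite mulrDr; rewrite big_split.
rewrite lee_fin; have [hy0|hy0] := leP (h y) 0; first by rewrite (le_trans hy0).
(* On [n]-th powers the limit [eps] to 0 only needs the continuity of the polynomial. *)
suff hn : h y ^+ n <= p y.
  rewrite FE -[leLHS](@powR_inv_exprn R n) ?(ltW hy0) //.
  by apply: (@ge0_ler_powR _ n%:R^-1) hn; rewrite ?invr_ge0 ?nnegrE ?exprn_ge0 ?p0 // ltW.
have cvg_p : (fun eps : R => mixed v (fun=> fun b => w y b + eps)) @ 0^'+ --> p y.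
  have E : p y = mixed v (fun=> fun b => w y b + 0).
    by congr mixed; apply/funext => _; apply/funext => b; rewrite addr0.
  rewrite E; apply: cvg_mixed => b; apply: cvgD; first exact: cvg_cst.
  exact: cvg_within.
rewrite -(cvg_lim _ cvg_p) //; apply: limr_ge; first by apply/cvg_ex; exists (p y).
near=> eps; have eps0 : 0 < eps by near: eps; exact: nbhs_right_gt.
rewrite -[leRHS](@exprn_powR_inv R n) //; last first.
  by apply: mixed_ge0 => _ b; rewrite addr_ge0 ?w0 // ltW.
by rewrite lerXn2r ?nnegrE ?powR_ge0 ?(ltW hy0) // main.
Unshelve. all: by end_near. Qed.
End MixedOfAverages.

(** * Random matrices *)

Section DeterminantPerturbation.
Variable R : realType.

(** The factors are exchanged one at a time; [1 <= L] allows the exponent [n] in place of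
    [n - 1]. *)
Lemma prod_dist n (a b : 'I_n -> R) (L delta : R) : 1 <= L -> 0 <= delta ->
    (forall i, `|a i| <= L) -> (forall i, `|b i| <= L) -> (forall i, `|a i - b i| <= delta) ->
  `|\prod_i a i - \prod_i b i| <= n%:R * L ^+ n * delta.
Proof.
move=> L1 d0; have L0 : 0 <= L by exact: le_trans L1.
elim: n a b => [|n IHn] a b aL bL ab.
  by rewrite !big_ord0 subrr normr0 mulr_ge0 ?mulr_ge0 ?exprn_ge0.
rewrite !big_ord_recl.
set A := \prod_(i < n) _; set B := \prod_(i < n) _.
have -> : a ord0 * A - b ord0 * B = (a ord0 - b ord0) * A + b ord0 * (A - B) by ring.
apply: (le_trans (ler_normD _ _)); rewrite !normrM.
have IH : `|A - B| <= n%:R * L ^+ n * delta by apply: IHn => i.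
have AL : `|A| <= L ^+ n.
  rewrite normr_prod -[n in leRHS]card_ord -prodr_const; apply: ler_prod => i _.
  by rewrite normr_ge0 aL.
have h1 : `|a ord0 - b ord0| * `|A| <= delta * L ^+ n by apply: ler_pM.
have h2 : `|b ord0| * `|A - B| <= L * (n%:R * L ^+ n * delta) by apply: ler_pM.
have h3 : delta * L ^+ n <= delta * L ^+ n.+1.
  by apply: ler_wpM2l => //; rewrite exprS ler_peMl // exprn_ge0.
apply: (le_trans (lerD (le_trans h1 h3) h2)).
by rewrite exprS -natr1 le_eqVlt; apply/orP; left; apply/eqP; ring.
Qed.

Lemma det_dist n (A B : 'M[R]_n) (L delta : R) : 1 <= L -> 0 <= delta ->
    (forall i j, `|A i j| <= L) -> (forall i j, `|B i j| <= L) ->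
    (forall i j, `|A i j - B i j| <= delta) ->
  `|\det A - \det B| <= n`!%:R * (n%:R * L ^+ n * delta).
Proof.
move=> L1 d0 AL BL AB; rewrite -sumrB; apply: (le_trans (ler_norm_sum _ _ _)).
apply: (@le_trans _ _ (\sum_(s : {perm 'I_n}) n%:R * L ^+ n * delta)).
  apply: ler_sum => s _; rewrite -mulrBr normrM normrX normrN1 expr1n mul1r.
  exact: prod_dist.
by rewrite sumr_const card_Sn -[leLHS]mulr_natl.
Qed.

Lemma det_bound n (A : 'M[R]_n) (L : R) : (forall i j, `|A i j| <= L) ->
  `|\det A| <= n`!%:R * L ^+ n.
Proof.
move=> AL; apply: (le_trans (ler_norm_sum _ _ _)).
apply: (@le_trans _ _ (\sum_(s : {perm 'I_n}) L ^+ n)).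
  apply: ler_sum => s _; rewrite normrM normrX normrN1 expr1n mul1r normr_prod.
  rewrite -[n in leRHS]card_ord -prodr_const; apply: ler_prod => i _.
  by rewrite normr_ge0 AL.
by rewrite sumr_const card_Sn -[leLHS]mulr_natl.
Qed.

(** The [n]-th root is Hölder continuous of exponent [1 / n], because
    [s ^+ n + t ^+ n <= (s + t) ^+ n] for nonnegative [s] and [t]. *)
Lemma expr_inv_dist n (a b e : R) : (0 < n)%N -> 0 <= a -> 0 <= b -> 0 <= e ->
  `|a - b| <= e ^+ n -> `|a `^ n%:R^-1 - b `^ n%:R^-1| <= e.
Proof.
move=> n0; have superadd (s t : R) : 0 <= s -> 0 <= t -> s ^+ n + t ^+ n <= (s + t) ^+ n.
  case: n n0 => // n _ s0 t0; elim: n => [|n IHn]; first by rewrite !expr1.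
  rewrite exprS (exprS t) [leRHS]exprS.
  apply: (@le_trans _ _ ((s + t) * (s ^+ n.+1 + t ^+ n.+1))).
    have := exprn_ge0 n.+1 s0; have := exprn_ge0 n.+1 t0; nra.
  by rewrite ler_wpM2l // addr_ge0.
have half (x y : R) : 0 <= x -> 0 <= y -> 0 <= e -> x - y <= e ^+ n ->
    x `^ n%:R^-1 - y `^ n%:R^-1 <= e.
  move=> x0 y0 e0 xy; rewrite lerBlDl -(@ler_pXn2r _ n) ?nnegrE ?addr_ge0 ?powR_ge0 //.
  apply: le_trans (superadd _ _ _ _) => //; last exact: powR_ge0.
  by rewrite !exprn_powR_inv // -lerBlDl.
move=> a0 b0 e0; rewrite ler_norml => /andP[ba ab]; rewrite ler_norml half // andbT.
by rewrite lerNl opprB half //; lra.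
Qed.
End DeterminantPerturbation.

Section RandomMatrixMeasurability.
Variables (R : realType) (n : nat) (d : measure_display) (T : measurableType d).
Variables (M : T -> 'M[R]_n).
Hypothesis mX : forall j, measurable_fun setT (fun w => col j (M w) : borel 'cV[R]_n).

Lemma measurable_entry i j : measurable_fun setT (fun w => M w i j).
Proof.
have -> : (fun w => M w i j) = (fun y : borel 'cV[R]_n => (y : 'cV[R]_n) i 0) \o
    (fun w => col j (M w) : borel 'cV[R]_n) by apply/funext => w; rewrite /= mxE.
apply: measurableT_comp => //; apply: continuous_borel_measurable => //.
exact: coord_continuous.
Qed.

Lemma measurable_absdet : measurable_fun setT (fun w => `|\det (M w)|).
Proof.
apply: measurableT_comp => //; apply: measurable_sum => s.
apply: measurable_funM; first exact: measurable_cst.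
by apply: measurable_prod => i _; exact: measurable_entry.
Qed.
End RandomMatrixMeasurability.

(** * Partition of a box into half-open cubes *)

Section Grid.
Variables (R : realType) (n l k : nat).
Implicit Types (y : 'cV[R]_n).

(** The interval from [- l.+1] to [l.+1] is cut into pieces of length [k.+1%:R^-1] in each
    coordinate; a cell is given by its position in every coordinate. *)
Definition grid_size := #|{: {ffun 'I_n -> 'I_(2 * l.+1 * k.+1)}}|.

(** The lower corner of a cell, as a row because [frame] stacks rows; transposition relates it to
    the columns of the random matrix. *)
Definition grid_point (b : 'I_grid_size) : 'rV[R]_n :=
  \row_i ((enum_val b i)%:R / k.+1%:R - l.+1%:R).

Definition grid_cell (b : 'I_grid_size) : set 'cV[R]_n :=
  [set y | forall i, grid_point b 0 i <= y i 0 < grid_point b 0 i + k.+1%:R^-1].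

Definition grid_box : set 'cV[R]_n := [set y | forall i, - l.+1%:R <= y i 0 < l.+1%:R].

Let k0 : (0 : R) < k.+1%:R. Proof. by rewrite ltr0n. Qed.

Lemma grid_cell_box b y : grid_cell b y -> grid_box y.
Proof.
move=> yb i; have := yb i; rewrite mxE => /andP[y1 y2]; apply/andP; split.
  by apply: le_trans y1; rewrite lerDr divr_ge0.
apply: (lt_le_trans y2); set e := enum_val b i.
have : (e : nat).+1%:R <= (2 * l.+1 * k.+1)%:R :> R by rewrite ler_nat ltn_ord.
rewrite -natr1 natrM natrM => h.
have : (e%:R + 1) / k.+1%:R <= 2 * l.+1%:R :> R by rewrite ler_pdivrMr.
rewrite mulrDl mul1r; set q := _ / _; set c := _^-1; set L := l.+1%:R; lra.
Qed.

Lemma grid_box_cell y : grid_box y -> exists b, grid_cell b y.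
Proof.
move=> yb; pose t i := (y i 0 + l.+1%:R) * k.+1%:R.
have t0 i : 0 <= t i by have /andP[y1 _] := yb i; rewrite mulr_ge0 //; lra.
have tlt i : (Num.truncn (t i) < 2 * l.+1 * k.+1)%N.
  rewrite -(ltr_nat R); have /andP[tr _] := truncn_itv (t0 i).
  apply: (le_lt_trans tr); rewrite /t natrM ltr_pM2r // natrM.
  by have /andP[_ y2] := yb i; lra.
exists (enum_rank [ffun i => Ordinal (tlt i)]) => i; rewrite mxE enum_rankK ffunE /=.
have /andP[t1 t2] := truncn_itv (t0 i).
rewrite lerBlDr ler_pdivrMr // t1 /=.
have : y i 0 + l.+1%:R < (Num.truncn (t i)).+1%:R / k.+1%:R by rewrite ltr_pdivlMr.
by rewrite -[(Num.truncn _).+1%:R]natr1 mulrDl mul1r; set q := _ / _; set c := _^-1; set L := l.+1%:R; lra.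
Qed.

Lemma grid_cell_inj b b' y : grid_cell b y -> grid_cell b' y -> b = b'.
Proof.
move=> yb yb'; apply/enum_val_inj/ffunP => i; apply/val_inj.
have := yb i; have := yb' i; rewrite !mxE.
set e := enum_val b i; set e' := enum_val b' i => /andP[h1 h2] /andP[h3 h4].
have le (p q : nat) : p%:R / k.+1%:R - l.+1%:R < q%:R / k.+1%:R - l.+1%:R + k.+1%:R^-1 :> R ->
    (p <= q)%N.
  move=> pq; have : p%:R / k.+1%:R < (q%:R + 1) / k.+1%:R :> R.
    by rewrite -(ltrD2r (- l.+1%:R)) mulrDl mul1r [ltRHS]addrAC.
  by rewrite ltr_pM2r ?invr_gt0 // natr1 ltr_nat ltnS.
apply/eqP; rewrite eqn_leq !le //; [exact: le_lt_trans h1 h4 | exact: le_lt_trans h3 h2].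
Qed.

Lemma grid_point_le b i : `|grid_point b 0 i| <= l.+1%:R.
Proof.
pose y : 'cV[R]_n := (grid_point b)^T.
have yE j : y j 0 = grid_point b 0 j by rewrite mxE.
have yb : grid_cell b y by move=> j; rewrite yE lexx ltrDl invr_gt0.
have := grid_cell_box yb i; rewrite yE => /andP[y1 y2].
by rewrite ler_norml y1 ltW.
Qed.

Lemma measurable_coordinate_set i (I : set R) : measurable I ->
  measurable ([set y | I (y i 0)] : set (borel 'cV[R]_n)).
Proof.
move=> mI; rewrite -[X in measurable X]setTI.
have mc : measurable_fun setT ((fun y : 'cV[R]_n => y i 0) : borel 'cV[R]_n -> R).
  by apply: continuous_borel_measurable => //; exact: coord_continuous.
exact: mc.
Qed.

Lemma measurable_grid_cell b : measurable (grid_cell b : set (borel 'cV[R]_n)).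
Proof.
rewrite (_ : grid_cell b = \bigcap_(i in setT)
    [set y : 'cV[R]_n | `[grid_point b 0 i, grid_point b 0 i + k.+1%:R^-1[%classic (y i 0)]).
  apply: fin_bigcap_measurable => // i _.
  exact: (@measurable_coordinate_set i _ (measurable_itv _)).
by apply/seteqP; split=> y /= H i; [move=> _|]; have := H i; rewrite /= in_itv //=; apply.
Qed.

Lemma measurable_grid_box : measurable (grid_box : set (borel 'cV[R]_n)).
Proof.
rewrite (_ : grid_box = \bigcap_(i in setT)
    [set y : 'cV[R]_n | `[- l.+1%:R, l.+1%:R[%classic (y i 0)]).
  apply: fin_bigcap_measurable => // i _.
  exact: (@measurable_coordinate_set i _ (measurable_itv _)).
by apply/seteqP; split=> y /= H i; [move=> _|]; have := H i; rewrite /= in_itv //=; apply.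
Qed.
End Grid.

Section TruncatedExpectation.
Variables (R : realType) (n : nat) (d : measure_display) (T : measurableType d).
Variables (P : probability T R) (M : T -> 'M[R]_n).
Hypothesis mX : forall j, measurable_fun setT (fun w => col j (M w) : borel 'cV[R]_n).

Definition in_box (l : nat) : set T := [set w | forall j, grid_box l (col j (M w))].

Definition truncated_absdet (l : nat) (w : T) : R := `|\det (M w)| * \1_(in_box l) w.

Definition truncated_expectation (l : nat) : R := \int[P]_w truncated_absdet l w.

Lemma measurable_column_event (A : 'I_n -> set (borel 'cV[R]_n)) :
  (forall j, measurable (A j)) -> measurable [set w | forall j, A j (col j (M w))].
Proof.
move=> mA; rewrite (_ : [set w | _] =
    \bigcap_(j in setT) ((fun w => col j (M w) : borel 'cV[R]_n) @^-1` A j)).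
  apply: fin_bigcap_measurable => // j _; rewrite -[X in measurable X]setTI.
  exact: mX.
by apply/seteqP; split=> w /= H j; [move=> _|]; apply: H.
Qed.

Lemma measurable_in_box l : measurable (in_box l).
Proof.
by apply: (@measurable_column_event (fun=> grid_box l)) => j; exact: measurable_grid_box.
Qed.

Lemma measurable_truncated l : measurable_fun setT (truncated_absdet l).
Proof.
apply: measurable_funM; first exact: measurable_absdet.
by apply: measurable_indic; exact: measurable_in_box.
Qed.

Lemma truncated_ge0 l w : 0 <= truncated_absdet l w.
Proof. by rewrite mulr_ge0 // indicE. Qed.

Lemma truncated_le l w : truncated_absdet l w <= n`!%:R * l.+1%:R ^+ n.
Proof.
rewrite /truncated_absdet indicE; have [/set_mem wl|_] := boolP (w \in in_box l).
  rewrite mulr1; apply: det_bound => i j; have := wl j i.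
  by rewrite mxE => /andP[h1 h2]; rewrite ler_norml h1 ltW.
by rewrite mulr0 mulr_ge0 ?exprn_ge0.
Qed.

Lemma bounded_integrable (f : T -> R) (c : R) : measurable_fun setT f ->
  (forall w, `|f w| <= c) -> P.-integrable setT (EFin \o f).
Proof.
move=> mf fc; apply: (@le_integrable _ _ _ P setT measurableT _ (EFin \o cst c)).
- exact/measurable_EFinP.
- by move=> w _; rewrite /= lee_fin (le_trans (fc w)) // ler_norm.
- exact: finite_measure_integrable_cst measurableT.
Qed.

Lemma truncated_integrable l : P.-integrable setT (EFin \o truncated_absdet l).
Proof.
apply: (@bounded_integrable _ (n`!%:R * l.+1%:R ^+ n)) => [|w]; first exact: measurable_truncated.
by rewrite ger0_norm ?truncated_ge0 // truncated_le.
Qed.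

Lemma Rintegral_dist (f g : T -> R) (c : R) : P.-integrable setT (EFin \o f) ->
    P.-integrable setT (EFin \o g) -> (forall w, `|f w - g w| <= c) ->
  `|\int[P]_w f w - \int[P]_w g w| <= c.
Proof.
move=> fi gi fg; rewrite -RintegralB //.
have int : P.-integrable setT (EFin \o (fun t => f t - g t)) by exact: (integrableB measurableT fi gi).
apply: le_trans (le_normr_Rintegral _ _) _ => //.
have -> : c = \int[P]_w c by rewrite Rintegral_cst //= probability_setT mulr1.
apply: le_Rintegral => //; first exact: integrable_norm.
exact: finite_measure_integrable_cst measurableT.
Qed.

(** By independence, [mixed] is the expectation of the absolute determinant after each column is
    rounded to the corner of its cell. Rounding moves the entries by at most [k.+1%:R^-1], which
    [det_dist] turns into the bound. *)
Lemma truncated_expectation_mixed (l k : nat) (nu : 'I_(grid_size n l k) -> R) :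
    (forall j b, P ((fun w => col j (M w) : 'cV[R]_n) @^-1` grid_cell b) = (nu b)%:E) ->
    mutually_independent P (fun j w => col j (M w) : borel 'cV[R]_n) ->
  `|truncated_expectation l - mixed (@grid_point R n l k) (fun=> nu)| <=
    n`!%:R * (n%:R * l.+1%:R ^+ n * k.+1%:R^-1).
Proof.
move=> lawX indX; set delta := n`!%:R * _.
pose gp := @grid_point R n l k.
pose E (a : {ffun 'I_n -> 'I_(grid_size n l k)}) : set T :=
  [set w | forall j, grid_cell (a j) (col j (M w))].
have mE a : measurable (E a).
  by apply: (@measurable_column_event (fun j => grid_cell (a j))) => j; exact: measurable_grid_cell.
pose s (a : {ffun 'I_n -> 'I_(grid_size n l k)}) w : R := `|\det (frame gp a)| * \1_(E a) w.
have si a : P.-integrable setT (EFin \o s a).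
  apply: (@bounded_integrable _ `|\det (frame gp a)|).
    by apply: measurable_funM; [exact: measurable_cst | exact: measurable_indic].
  move=> w; rewrite /s indicE normrM normr_id ler_piMr //.
  by case: (_ \in _); rewrite ?normr1 ?normr0.
have [Si Sint] := Rintegral_bigsum (index_enum _) measurableT si.
have -> : mixed gp (fun=> nu) = \int[P]_w \sum_a s a w.
  rewrite Sint; apply: eq_bigr => a _; rewrite RintegralZl //; last first.
    apply: (@bounded_integrable _ 1); first exact: measurable_indic.
    by move=> w; rewrite indicE; case: (_ \in _); rewrite ?normr1 ?normr0.
  rewrite mulrC; congr (_ * _); rewrite /Rintegral integral_indic // setIT.
  have PE : P (E a) = (\prod_(j < n) nu (a j))%:E.
    rewrite -prodEFin.
    transitivity (\prod_(j < n) P ((fun w => col j (M w) : 'cV[R]_n) @^-1` grid_cell (a j)))%E.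
      by apply: (indX (fun j => grid_cell (a j))) => j; exact: measurable_grid_cell.
    by apply: eq_bigr => j _; exact: lawX.
  by rewrite -[LHS]/(fine (\prod_(j < n) nu (a j))%:E); congr fine; exact/esym/PE.
apply: Rintegral_dist => // [|w]; first exact: truncated_integrable.
(* Outside the box both integrands vanish; inside it exactly one choice [a] of cells contributes. *)
rewrite /truncated_absdet indicE; have [/set_mem wl|wl] := boolP (w \in in_box l); last first.
  rewrite mulr0 big1 ?subrr ?normr0 ?mulr_ge0 ?exprn_ge0 ?invr_ge0 // => a _.
  rewrite /s indicE memNset ?mulr0 // => Ew; move/negP: wl; apply; apply/mem_set => j.
  exact: grid_cell_box (Ew j).
have [a0 wa0] := choice (fun j => grid_box_cell k (wl j)).
pose a : {ffun 'I_n -> 'I_(grid_size n l k)} := [ffun j => a0 j].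
rewrite (bigD1 a) //= big1 ?addr0 => [|a' aa']; last first.
  rewrite /s indicE memNset ?mulr0 // => Ew; move/eqP: aa'; apply.
  by apply/ffunP => j; rewrite ffunE; exact: grid_cell_inj (Ew j) (wa0 j).
rewrite mulr1 /s indicE mem_set; last by move=> j; rewrite ffunE.
rewrite mulr1; apply: le_trans (ler_dist_dist _ _) _; rewrite -[\det (frame _ _)]det_tr.
apply: det_dist => //; rewrite ?(ler_nat _ 1) ?invr_ge0 // => i j.
- by have := wl j i; rewrite mxE => /andP[h1 h2]; rewrite ler_norml h1 ltW.
- by rewrite !mxE; have := grid_point_le R (a j) i; rewrite mxE.
- rewrite mxE [frame _ _ _ _]mxE ffunE; have := wa0 j i; rewrite [col _ _ _ _]mxE.
  by move=> /andP[h1 h2]; rewrite ger0_norm ?subr_ge0 // lerBlDl ltW.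
Qed.
End TruncatedExpectation.

(** * Removal of the truncation *)

Section TruncationLimit.
Variables (R : realType) (n : nat) (d : measure_display) (T : measurableType d).
Variables (P : probability T R) (M : T -> 'M[R]_n).
Hypothesis mX : forall j, measurable_fun setT (fun w => col j (M w) : borel 'cV[R]_n).

Lemma truncated_absdet_mono w : {homo truncated_absdet M ^~ w : k l / (k <= l)%N >-> k <= l}.
Proof.
move=> k l kl; rewrite /truncated_absdet ler_wpM2l // !indicE ler_nat.
have [/set_mem wk|//] := boolP (w \in in_box M k); rewrite mem_set // => j i.
have := wk j i; have : k.+1%:R <= l.+1%:R :> R by rewrite ler_nat.
by move=> kl' /andP[h1 h2]; apply/andP; split; lra.
Qed.

Lemma truncated_expectation_mono k l : (k <= l)%N ->
  truncated_expectation P M k <= truncated_expectation P M l.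
Proof.
move=> kl; apply: le_Rintegral => //; try exact: truncated_integrable.
by move=> w _; exact: truncated_absdet_mono.
Qed.

Lemma truncated_expectation_ge0 l : 0 <= truncated_expectation P M l.
Proof. by apply: Rintegral_ge0 => w _; exact: truncated_ge0. Qed.

Lemma truncated_expectationE l :
  (truncated_expectation P M l)%:E = (\int[P]_w (truncated_absdet M l w)%:E)%E.
Proof.
by rewrite fineK //; apply: integrable_fin_num => //; exact: truncated_integrable.
Qed.

Lemma truncated_expectation_le l :
  ((truncated_expectation P M l)%:E <= expected_abs_det P M)%E.
Proof.
rewrite truncated_expectationE /expected_abs_det unlock.
apply: ge0_le_integral => //.
- by move=> w _; rewrite lee_fin truncated_ge0.
- by apply/measurable_EFinP; exact: measurable_truncated.
- by apply/measurable_EFinP; exact: measurable_absdet.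
- by move=> w _; rewrite lee_fin /truncated_absdet ler_piMr // indicE; case: (_ \in _).
Qed.

(** Monotone convergence, which covers an infinite expectation as well. *)
Lemma truncated_expectation_sup (a : R) : (a%:E < expected_abs_det P M)%E ->
  exists l, a < truncated_expectation P M l.
Proof.
move=> aE; apply: contrapT => /forallNP nl; move: aE; apply/negP; rewrite -leNgt.
rewrite /expected_abs_det unlock.
have -> : (\int[P]_w (`|\det (M w)|)%:E =
    \int[P]_w limn (fun l => (truncated_absdet M l w)%:E))%E.
  apply: eq_integral => w _; apply/esym/cvg_lim => //; apply: cvg_near_cst.
  (* This dominates every entry, so the truncation is inactive at [w] once [l] is at least [b]. *)
  pose b : R := \sum_i \sum_j `|M w i j|.
  apply: filterS (nbhs_infty_ger b) => l bl; congr (_%:E).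
  rewrite /truncated_absdet indicE mem_set ?mulr1 // => j i; rewrite mxE.
  have le_b : `|M w i j| <= b.
    rewrite /b (bigD1 i) //= (bigD1 j) //= -addrA lerDl addr_ge0 ?sumr_ge0 // => i' _.
    exact: sumr_ge0.
  have : `|M w i j| < l.+1%:R by rewrite -natr1; lra.
  by rewrite ltr_norml => /andP[h1 h2]; rewrite h2 ltW.
rewrite monotone_convergence //.
- apply: lime_le.
    apply: ereal_nondecreasing_is_cvgn => k l kl.
    by rewrite -!truncated_expectationE lee_fin truncated_expectation_mono.
  by near=> l; rewrite -truncated_expectationE lee_fin leNgt; apply/negP/nl.
- by move=> l; apply/measurable_EFinP; exact: measurable_truncated.
- by move=> l w _; rewrite lee_fin truncated_ge0.
- by move=> w _ k l kl; rewrite lee_fin; exact: truncated_absdet_mono.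
Unshelve. all: by end_near. Qed.
End TruncationLimit.

(* The family Y carries both the given Y_t, t in the boundary, and the
   Y_x, x in Omega (these two sets are disjoint, Omega being open). The random
   vectors Y_t and the matrices M_{Y_x} may live on different probability
   spaces. *)
Theorem theorem4p1 (R : realType) (m n : nat) (n_gt0 : (0 < n)%N)
  (Omega : set 'rV[R]_m) (domOmega : smoothly_bounded_domain Omega)
  (mu : 'rV[R]_m -> probability (borel 'rV[R]_m) R)
  (mu_harm : is_harmonic_measure Omega mu)
  (dS : measure_display) (S : 'rV[R]_m -> measurableType dS)
  (Q : forall t : 'rV[R]_m, probability (S t) R)
  (Y : forall t : 'rV[R]_m, {RV (Q t) >-> borel 'cV[R]_n})
  (Y_fin : forall t : 'rV[R]_m, boundary Omega t -> finite_expectation (Y t))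
  (Y_meas : forall A : set (borel 'cV[R]_n), measurable A ->
    measurable_fun (boundary Omega : set (borel 'rV[R]_m))
      (fun t => distribution (Q t) (Y t) A))
  (Y_mix : forall x, Omega x ->
    forall A : set (borel 'cV[R]_n), measurable A ->
    distribution (Q x) (Y x) A =
      (\int[mu x]_(t in boundary Omega) distribution (Q t) (Y t) A)%E)
  (dT : measure_display) (T : 'rV[R]_m -> measurableType dT)
  (P : forall x : 'rV[R]_m, probability (T x) R)
  (M : forall x : 'rV[R]_m, T x -> 'M[R]_n)
  (M_iid : forall x, Omega x -> iid_columns (P x) (M x) (Y x)) :
  superharmonic_on Omega
    (fun x => (expected_abs_det (P x) (M x) `^ (n%:R^-1)%R)%E).
Proof.
have oO : open Omega by case: domOmega.
have inv_n0 : 0 < n%:R^-1 :> R by rewrite invr_gt0 ltr0n.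
pose Et l x := truncated_expectation (P x) (M x) l.
have Et0 l x : 0 <= Et l x by exact: truncated_expectation_ge0.
have superEt l : superharmonic_on Omega (EFin \o (fun x => Et l x `^ n%:R^-1)).
  apply: superharmonic_on_uniform_limit => e e0.
  pose C : R := n`!%:R * (n%:R * l.+1%:R ^+ n).
  have C0 : 0 <= C by rewrite !mulr_ge0 // exprn_ge0.
  have en : 0 < e ^+ n by rewrite exprn_gt0.
  (* The discretization error [C / k.+1] is brought below [e ^+ n], so that the [n]-th roots differ
     by at most [e]. *)
  pose k := Num.bound (C / e ^+ n).
  have Ck : C * k.+1%:R^-1 <= e ^+ n.
    have : C / e ^+ n < k.+1%:R.
      by apply: lt_trans (archi_boundP _) _; rewrite ?divr_ge0 ?(ltW en) ?ltr_nat.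
    by rewrite ltr_pdivrMr // ler_pdivrMr // mulrC => /ltW.
  pose A (b : 'I_(grid_size n l k)) : set (borel 'cV[R]_n) := grid_cell b.
  have mA b : measurable (A b) by exact: measurable_grid_cell.
  (* The mass of the cell [b] under the law at the boundary point [t]. By the mixture formula its
     average at [x] is the mass of the cell under the law of [Y x]. *)
  pose g b t : R := fine (distribution (Q t) (Y t) (A b)).
  have finA t b : distribution (Q t) (Y t) (A b) \is a fin_num by exact: fin_num_measure.
  have ug b : unit_valued Omega (g b).
    split=> [|t _].
      by apply: measurableT_comp; [exact: fine_measurable | exact: Y_meas].
    by rewrite /g -!lee_fin fineK // measure_ge0 probability_le1.
  have avg b x : Omega x -> (average Omega mu (g b) x)%:E = distribution (Q x) (Y x) (A b).
    move=> Ox; rewrite /average /Rintegral.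
    have <- : (\int[mu x]_(t in boundary Omega) distribution (Q t) (Y t) (A b) =
        \int[mu x]_(t in boundary Omega) (g b t)%:E)%E.
      by apply: eq_integral => t _; rewrite fineK.
    by rewrite -Y_mix // fineK.
  exists (fun x => mixed (@grid_point R n l k) (fun=> fun b => average Omega mu (g b) x) `^ n%:R^-1).
    exact: (superharmonic_mixed_average oO mu_harm _ ug n_gt0).
  move=> x Ox; have [mX law ind] := M_iid _ Ox.
  apply: expr_inv_dist => //; last 2 first.
  - exact: ltW.
  - apply: le_trans Ck; rewrite /C -mulrA.
    apply: truncated_expectation_mixed => // j b.
    by rewrite law //; exact/esym/avg.
  - by apply: mixed_ge0 => _ b; have /andP[] := average01 mu_harm Ox (ug b).
apply: (@superharmonic_on_sup R m Omega
  (fun l => EFin \o (fun x => Et l x `^ n%:R^-1)) _ superEt).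
- move=> k l x Ox kl; have [mX _ _] := M_iid _ Ox; rewrite lee_fin.
  apply: (@ge0_ler_powR _ n%:R^-1); rewrite ?nnegrE ?Et0 ?(ltW inv_n0) //.
  exact: truncated_expectation_mono.
- move=> l x Ox; have [mX _ _] := M_iid _ Ox; rewrite /= -poweR_EFin.
  have le_E := truncated_expectation_le (P x) mX l.
  have Ex0 : (0 <= expected_abs_det (P x) (M x))%E by apply: le_trans le_E; rewrite lee_fin Et0.
  apply: gt0_ler_poweR le_E; first exact: ltW.
    by rewrite in_itv /= lee_fin Et0 leey.
  by rewrite in_itv /= Ex0 leey.
- move=> x a Ox aF; have [mX _ _] := M_iid _ Ox.
  (* Roots are nonnegative, so any truncation exceeds a negative level; for [0 <= a] the supremum is
     taken at level [a ^+ n] before roots. *)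
  have [a0|a0] := ltP a 0; first by exists 0%N; rewrite lte_fin (lt_le_trans a0) // powR_ge0.
  have : ((a ^+ n)%:E < expected_abs_det (P x) (M x))%E.
    rewrite ltNge; apply/negP => le_a; move: aF; apply/negP; rewrite -leNgt.
    rewrite -[X in (_ <= X%:E)%E](@powR_inv_exprn R n) // -poweR_EFin.
    have E0 : (0 <= expected_abs_det (P x) (M x))%E.
      by apply: le_trans (truncated_expectation_le (P x) mX 0); rewrite lee_fin Et0.
    apply: gt0_ler_poweR le_a; first exact: ltW.
      by rewrite in_itv /= E0 leey.
    by rewrite in_itv /= lee_fin exprn_ge0 // leey.
  move=> /(truncated_expectation_sup mX)[l al]; exists l.
  rewrite lte_fin -[ltLHS](@powR_inv_exprn R n) //.
  by apply: gt0_ltr_powR; rewrite ?nnegrE ?exprn_ge0 ?Et0.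
Qed.
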